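(* It is decidable, given a language $L$ accepted by a (one-way nondeterministic) reversal-bounded $k$-flip pushdown automaton, whether $L$ is dense. That is, there is an algorithm which, given an integer $k \ge 0$ and a reversal-bounded $k$-flip pushdown automaton $M$ with input alphabet $\Sigma$ (together with a reversal bound for $M$), decides whether $\inf(L(M)) = \Sigma^*$.
   Context: For an alphabet $\Sigma$ and $L \subseteq \Sigma^*$, let $\inf(L) = \{y \in \Sigma^* \mid xyz \in L \text{ for some } x,z \in \Sigma^*\}$. $L$ is dense if $\inf(L) = \Sigma^*$. A (one-way nondeterministic) $k$-flip pushdown automaton is a nondeterministic pushdown automaton with a one-way read-only input, with $\lambda$-transitions allowed, which, in addition to the usual push and pop transitions, has flip transitions. A flip transition replaces the current pushdown contents above the bottom-of-pushdown marker by its reversal (the bottom marker stays at the bottom). At most $k$ flips may be performed in a computation. A word is accepted if some computation (with at most $k$ flips) reads the entire word and ends in a final state. $L(M)$ denotes the set of accepted words. The automaton is reversal-bounded if there is an integer $l$ such that on every accepting computation the number of switches between increasing and decreasing the size of the pushdown is at most $l$. Such an $l$ is a reversal bound. *)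

(* Defs.v *)
From mathcomp Require Import all_boot.

Set Implicit Arguments.
Unset Strict Implicit.
Unset Printing Implicit Defensive.

(* Kleene's partial recursive functions, indexed by their arity. *)
Inductive recfun : nat -> Type :=
  | RZero n : recfun n
  | RSucc : recfun 1
  | RProj n (i : 'I_n) : recfun n
  | RComp m n (f : recfun m) (gs : 'I_m -> recfun n) : recfun n
  | RPrec n (f : recfun n) (g : recfun n.+2) : recfun n.+1
  | RMu n (f : recfun n.+1) : recfun n.

(* [computes f v r]: [f] is defined at [v], with value [r].  In the case of
   primitive recursion, [t] lists the intermediate values, with
     t 0 = f(v'),  t (i+1) = g(i, t i, v')  where v = (v0, v'). *)
Fixpoint computes n (f : recfun n) : n.-tuple nat -> nat -> Prop :=
  match f in recfun n return n.-tuple nat -> nat -> Prop with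
  | RZero _ => fun _ r => r = 0
  | RSucc => fun v r => r = (thead v).+1
  | RProj _ i => fun v r => r = tnth v i
  | RComp m _ f gs => fun v r =>
      exists2 w : m.-tuple nat,
        forall i, computes (gs i) v (tnth w i) & computes f w r
  | RPrec n f g => fun v r =>
      let v' : n.-tuple nat := [tuple of behead v] in
      exists t : nat -> nat,
        [/\ computes f v' (t 0),
            forall i, i < thead v ->
              computes g [tuple of i :: t i :: v'] (t i.+1)
          & r = t (thead v)]
  | RMu _ f => fun v r =>
      computes f [tuple of r :: v] 0 /\
      forall i, i < r -> exists y, computes f [tuple of i :: v] y.+1
  end.

Definition infixes (A : Type) (L : seq A -> Prop) (y : seq A) : Prop :=
  exists x z, L (x ++ y ++ z).

Definition dense (A : Type) (L : seq A -> Prop) : Prop :=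
  forall y, infixes L y.

Section FlipPushdown.

Variables Sigma Gamma Q : finType.

(* [(p, a, X, r, u)]: from state [p], reading [a] ([None] for a lambda-move)
   with [X] on top ([None] for the bottom-of-pushdown marker), go to state [r]
   and replace [X] by the string [u], whose head becomes the new top; the bottom
   marker is never removed, [u] being written above it. *)
Definition transition : Type :=
  Q * option Sigma * option Gamma * Q * seq Gamma.

Record flip_pda := FlipPda {
  init : Q;
  final : {set Q};
  delta : seq transition;
  flips : {set Q * Q}
}.

(* State, unread input, and pushdown contents above the bottom marker, top
   first; the marker itself is implicit. *)
Definition config : Type := Q * seq Sigma * seq Gamma.

Definition height (c : config) : nat := size c.2.

Definition ocons (T : Type) (x : option T) (s : seq T) : seq T :=
  if x is Some y then y :: s else s.

Variable M : flip_pda.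

Inductive move : config -> config -> Prop :=
  | MoveTop p a x r u w s : (p, a, Some x, r, u) \in delta M ->
      move (p, ocons a w, x :: s) (r, w, u ++ s)
  | MoveBottom p a r u w : (p, a, None, r, u) \in delta M ->
      move (p, ocons a w, [::]) (r, w, u).

(* [computation c n hs c']: a computation from [c] to [c'] with [n] flips and
   successive pushdown heights [hs]. *)
Inductive computation : config -> nat -> seq nat -> config -> Prop :=
  | CompNil c : computation c 0 [:: height c] c
  | CompMove c1 c2 c3 n hs :
      move c1 c2 -> computation c2 n hs c3 ->
      computation c1 n (height c1 :: hs) c3
  | CompFlip p q w s c n hs :
      (p, q) \in flips M -> computation (q, w, rev s) n hs c ->
      computation (p, w, s) n.+1 (size s :: hs) c.

Variable k : nat.

Definition accepting_computation (w : seq Sigma) (hs : seq nat) : Prop :=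
  exists n q s,
    [/\ n <= k, q \in final M
      & computation (init M, w, [::]) n hs (q, [::], s)].

Definition language (w : seq Sigma) : Prop :=
  exists hs, accepting_computation w hs.

(* Successive strict changes of height: [true] for an increase, [false] for a
   decrease. *)
Definition directions (hs : seq nat) : seq bool :=
  [seq h.1 < h.2 | h <- zip hs (behead hs) & h.1 != h.2].

Definition switches (hs : seq nat) : nat :=
  let ds := directions hs in
  count (fun d => d.1 != d.2) (zip ds (behead ds)).

Definition reversal_bound (l : nat) : Prop :=
  forall w hs, accepting_computation w hs -> switches hs <= l.

End FlipPushdown.

(* Instances as natural numbers: [CodeSeq.code] is the bijection
   [:: n1; n2; ...] |-> 2 ^ n1 * (2 * code [:: n2; ...] + 1)
   from lists of numbers to numbers. *)
Section Encoding.

Variables s g q : nat.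

Definition code_option n (x : option 'I_n) : nat :=
  if x is Some i then i.+1 else 0.

Definition code_transition (t : transition 'I_s 'I_g 'I_q) : nat :=
  let: (p, a, x, r, u) := t in
  CodeSeq.code [:: val p; code_option a; code_option x; val r;
                   CodeSeq.code (map val u)].

Definition code_pda (M : flip_pda 'I_s 'I_g 'I_q) : nat :=
  CodeSeq.code
    [:: s; g; q; val (init M);
        CodeSeq.code [seq val p | p <- enum (final M)];
        CodeSeq.code [seq code_transition t | t <- delta M];
        CodeSeq.code
          [seq CodeSeq.code [:: val e.1; val e.2] | e <- enum (flips M)]].

Definition code_instance (k l : nat) (M : flip_pda 'I_s 'I_g 'I_q) : nat :=
  CodeSeq.code [:: k; l; code_pda M].

End Encoding.

(* Main.v *)
(** Forget the input letters.  Whether a configuration can reach acceptance with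
    [j] more flips, or can be reached with [j] flips, depends on a bottom part of
    the pushdown only through a finite class: closing a set of configurations
    under moves multiplies the number of classes by an elementary factor, and a
    flip, which turns bottom classes into top classes, costs an exponential.

    Let [l] be a reversal bound.  If [y ^ (k + l + 1)] is an infix of an accepted
    word, then some copy of [y] is read without a flip and without a change of
    direction of the pushdown.  Conversely a word read in this way on an accepting
    computation is an infix, and whether a word is of this kind is determined by
    its relation between abstract configurations (state, top symbol, class of
    the rest).  By pumping, if some word is not of this kind then a short one is
    not, and a power of it is not an infix.  So density only has to be tested on
    words of bounded length.

    For a given [y], being an infix is the reachability of a final state in the
    product of the automaton with the positions of [y].  A chain of finite sets
    indexed by the running time stabilises early, which bounds the length of a
    shortest run.  All bounds are primitive recursive, hence so is the search for
    coded runs. *)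

Require Import Defs.
From mathcomp Require Import all_boot.
From mathcomp Require Import boolp zify.

Set Implicit Arguments.
Unset Strict Implicit.
Unset Printing Implicit Defensive.

(** * Finite sets, increasing chains and the function [tower] *)

Lemma card_set_of (T : finType) : #|{set T}| = 2 ^ #|T|.
Proof. by rewrite -[LHS]cardsT -powersetT card_powerset cardsT. Qed.

Lemma card_set_le (T : finType) n : #|T| <= n -> #|{set T}| <= 2 ^ n.
Proof. by move=> le_n; rewrite card_set_of leq_exp2l. Qed.

Lemma asbool_impl (P P' : Prop) : `[< P >] = `[< P' >] -> P -> P'.
Proof. by move=> e /asboolP; rewrite e => /asboolP. Qed.

(* Bound on the number of classes after [j] flips; the exponent [N * N.+1 ^ N]
   counts the states paired with words of length at most [N]. *)
Fixpoint tower N j : nat :=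
  (if j is i.+1 then 2 ^ (N.+1 * tower N i) else 2) * 2 ^ (N * N.+1 ^ N).

(** A chain of subsets of [T] cannot grow strictly more than [#|T|] times. Sampling it along the
    iterates of [g] gives stability over a whole stride of [g], long enough for one round of the
    saturation arguments below. *)
Lemma chain_stable (T : finType) (D : nat -> {set T}) g :
    (forall m n, m <= n -> D m \subset D n) -> (forall n, n <= g n) ->
  exists2 i, i <= #|T| & D (iter i.+1 g 0) \subset D (iter i g 0).
Proof.
move=> Dmono g_ge; apply: contrapT => noi.
suff le i : i <= #|T|.+1 -> i <= #|D (iter i g 0)|.
  by have:= leq_trans (le _ (leqnn _)) (max_card _); rewrite ltnn.
elim: i => // i IHi lt_i; apply: leq_ltn_trans (IHi (ltnW lt_i)) _.
apply: proper_card; rewrite properE Dmono ?g_ge //=.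
by apply/negP => sub; apply: noi; exists i.
Qed.

Lemma leq_tower N i j : i <= j -> tower N i <= tower N j.
Proof.
move/subnK <-; elim: (j - i) => // d IHd; apply: leq_trans IHd _.
rewrite addSn /= -[X in X <= _]muln1 leq_mul ?expn_gt0 //.
(* The factor [N.+1] in the exponent makes this work for [N = 0] too. *)
exact: leq_trans (ltnW (ltn_expl _ _)) (leq_pexp2l _ (leq_pmull _ _)).
Qed.

(** * Pushdown systems with flips *)

Section System.

Variables (S G : finType) (N : nat).
Variables (tr : S -> option G -> S -> seq G -> Prop) (fl : S -> S -> Prop).
Hypothesis cardS : #|S| <= N.
Hypothesis cardG : #|G| <= N.
Hypothesis tr_size : forall p x r u, tr p x r u -> size u <= N.

Local Notation conf := (S * seq G)%type.

Inductive step : conf -> conf -> Prop :=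
  | StepTop p x r u s : tr p (Some x) r u -> step (p, x :: s) (r, u ++ s)
  | StepBottom p r u : tr p None r u -> step (p, [::]) (r, u).

Fixpoint within (C : conf -> Prop) n c : Prop :=
  C c \/ if n is m.+1 then exists2 c', step c c' & within C m c' else False.

Definition pre C c : Prop := exists n, within C n c.

Inductive post (C : conf -> Prop) : conf -> Prop :=
  | PostRefl c : C c -> post C c
  | PostStep c c' : post C c -> step c c' -> post C c'.

(** Reversal is an involution, so the same formula serves for predecessors and for successors of a
    flip; only [R] is replaced by its converse. *)
Definition flipped (R : S -> S -> Prop) (C : conf -> Prop) (c : conf) : Prop :=
  exists2 q, R c.1 q & C (q, rev c.2).

(** A Myhill-Nerode index for pushdown bottoms: equivalent bottoms can be exchanged under every
    state and every top part. One implication suffices, as [w] and [w'] may be swapped. *)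
Definition index_le (C : conf -> Prop) n : Prop :=
  exists cl : seq G -> 'I_n, forall w w', cl w = cl w' ->
    forall p v, C (p, v ++ w) -> C (p, v ++ w').

Lemma index_fin (T : finType) (cl : seq G -> T) C n : #|T| <= n ->
  (forall w w', cl w = cl w' -> forall p v, C (p, v ++ w) -> C (p, v ++ w')) ->
  index_le C n.
Proof.
move=> le_n clP; exists (fun w => widen_ord le_n (enum_rank (cl w))) => w w' e.
by apply: clP; apply: enum_rank_inj; apply: val_inj; move/(congr1 val): e.
Qed.

Lemma index_leW C n m : n <= m -> index_le C n -> index_le C m.
Proof.
by move=> le_nm [cl clP]; apply: (index_fin (cl := cl)); rewrite ?card_ord.
Qed.

(** Until [w] is uncovered a run depends only on the part above it. At that moment only the state
    [q] matters, so the old class is refined by the set of those [q] from which [(q, w)] leads to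
    [C]. *)
Lemma pre_index C n : index_le C n -> index_le (pre C) (n * 2 ^ N).
Proof.
case=> cl clP; pose cl' w := (cl w, [set q | `[< pre C (q, w) >]]).
apply: (index_fin (cl := cl')) => [|w w' [ecl /setP epre] p v [m]].
  by rewrite card_prod card_ord leq_mul2l card_set_le ?orbT.
have base q : pre C (q, w) -> pre C (q, w').
  by have:= epre q; rewrite !inE => /asbool_impl.
elim: m p v => [|m IHm] p [|x v].
- by move=> Cpw; apply: base; exists 0.
- by case=> // /(clP _ _ ecl) ?; exists 0; left.
- by move=> Cpw; apply: base; exists m.+1.
case=> [/(clP _ _ ecl) ? | [c' st]]; first by exists 0; left.
move Ec: (p, (x :: v) ++ w) st => c st; case: st Ec => // p0 x0 r u s tru.
case=> Ep Ex Es; rewrite -Es -Ep -Ex in tru *; rewrite catA => /IHm[n0 ?].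
by exists n0.+1; right; exists (r, (u ++ v) ++ w'); rewrite // -catA; apply: StepTop.
Qed.

(* A run into [v ++ w] with [v] long passes through some [v' ++ w] with
   [size v' <= N], as one move writes at most [N] symbols. *)
Lemma post_index C n :
  index_le C n -> index_le (post C) (n * 2 ^ (N * N.+1 ^ N)).
Proof.
case=> cl clP.
(* Words of length at most [N] are coded as functions into [option G], which form a finite type with
   at most [N.+1 ^ N] elements. *)
pose dat (v : seq G) := [ffun i : 'I_N => onth v i].
have dat_inj v v' : size v <= N -> size v' <= N -> dat v = dat v' -> v = v'.
  move=> sv sv' /ffunP e; apply/eq_from_onth => i.
  have [ltiN|leNi] := ltnP i N; first by have:= e (Ordinal ltiN); rewrite !ffunE.
  by rewrite !onth_default ?(leq_trans sv) ?(leq_trans sv').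
pose cl' w := (cl w, [set e : S * {ffun 'I_N -> option G} |
  `[< exists v, [/\ size v <= N, dat v = e.2 & post C (e.1, v ++ w)] >]]).
apply: (index_fin (cl := cl')) => [|w w' [ecl /setP epost] p v].
  rewrite card_prod card_ord leq_mul2l card_set_le ?orbT // card_prod.
  rewrite leq_mul // card_ffun card_option card_ord.
  by case: (N) cardG => // n0 ?; rewrite leq_exp2r.
have base q v0 (sv0 : size v0 <= N) : post C (q, v0 ++ w) -> post C (q, v0 ++ w').
  have := epost (q, dat v0); rewrite !inE => /asbool_impl.
  move=> imp Cqw; have [v1 [sv1 e Cv1]] := imp (ex_intro _ v0 (And3 sv0 erefl Cqw)).
  by rewrite -(dat_inj v1 v0).
move Ec: (p, v ++ w) => c Cc; elim: Cc p v Ec => {}c.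
  by move=> Cc p v Ec; apply: PostRefl; apply: clP ecl _ _ _; rewrite Ec.
move=> c' Cc IHc st p v Ec; subst c'.
have [leN|ltN] := leqP (size v) N.
  by apply: base => //; apply: PostStep Cc st.
move Ec': (p, v ++ w) st => c' st; case: st Ec' Cc IHc.
  move=> p0 x r u s tru [-> evw] Cc IHc; have su := tr_size tru.
  have:= congr1 (take (size u)) evw; have:= congr1 (drop (size u)) evw.
  rewrite (drop_size_cat s erefl) (take_size_cat s erefl) drop_cat take_cat.
  rewrite (leq_ltn_trans su ltN) => es eu; rewrite -[v](cat_take_drop (size u)).
  rewrite eu -catA; apply: PostStep (StepTop _ tru).
  by apply: (IHc p0 (x :: drop (size u) v)); rewrite /= es.
move=> p0 r u /tr_size su [_ eu]; move: su; rewrite -eu size_cat; lia.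
Qed.


(** After the flip the bottom [w] is the top [rev w], above some unknown word. That word counts only
    through its class, so [w] is described by the set of pairs of a state and a class that it sends
    into [C]. *)
Lemma flipped_index R C n : index_le C n -> index_le (flipped R C) (2 ^ (N.+1 * n)).
Proof.
case=> cl clP; pose dat w := [set e : S * 'I_n |
  `[< exists v, cl v = e.2 /\ C (e.1, rev w ++ v) >]].
apply: (index_fin (cl := dat)) => [|w w' /setP edat p v [q /= Rpq]].
  by rewrite card_set_le // card_prod card_ord leq_mul2r (leqW cardS) orbT.
rewrite rev_cat => Cqw; exists q; rewrite //= rev_cat.
have:= edat (q, cl (rev v)); rewrite !inE => /asbool_impl imp.
by have [|v' [/clP eq /eq]] := imp; first by exists (rev v).
Qed.

(** * Time bounds for reaching a target without flips *)

Section TimeBound.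

Variables (I : nat) (C : conf -> Prop).
Hypothesis C_index : index_le C I.

(* Runs on [v ++ w] that do not look below [v]: they stop as soon as [v] has
   been erased, in a state of [E], or when [C] is reached. *)
Fixpoint above w (E : {set S}) n p v : Prop :=
  v = [::] /\ p \in E \/ C (p, v ++ w) \/
  if n is m.+1 then
    exists x v' r u, [/\ v = x :: v', tr p (Some x) r u & above w E m r (u ++ v')]
  else False.

Lemma above0 w E n p v : above w E 0 p v -> above w E n p v.
Proof. by case: n => [|n] //= [|[]]; auto. Qed.

Lemma aboveS w E n p v : above w E n p v -> above w E n.+1 p v.
Proof.
elim: n p v => [|n IHn] p v; first exact: above0.
case=> [|[|[x [v' [r [u [ev tru /IHn]]]]]]]; [by left | by right; left|].
by right; right; exists x, v', r, u.
Qed.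

Lemma above_mono w E m n p v : m <= n -> above w E m p v -> above w E n p v.
Proof. by move/subnK <-; elim: (n - m) => // d IHd /IHd /aboveS. Qed.

Lemma above_sub w (E E' : {set S}) n p v :
  E \subset E' -> above w E n p v -> above w E' n p v.
Proof.
move=> sub; elim: n p v => [|n IHn] p v.
  by case=> [[-> /(subsetP sub) ?]|[]]; [left | right; left |].
case=> [[-> /(subsetP sub) ?]|[|[x [v' [r [u [ev tru /IHn]]]]]]].
- by left.
- by right; left.
by right; right; exists x, v', r, u.
Qed.

(** The upper part has to be erased first, unless [C] is reached before; its exit states are those
    from which the lower part can be completed. *)
Lemma above_split w E n p v1 v2 : above w E n p (v1 ++ v2) ->
  above (v2 ++ w) [set q | `[< above w E n q v2 >]] n p v1.
Proof.
elim: n p v1 => [|n IHn] p [|x v1] H.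
- by left; rewrite inE; split=> //; apply/asboolP.
- by case: H => [[]|[]] //; right; left; rewrite catA.
- by left; rewrite inE; split=> //; apply/asboolP.
case: H => [[]|[]] //; first by right; left; rewrite catA.
case=> _ [_ [r [u [[<- <-] tru]]]]; rewrite catA => /IHn H.
right; right; exists x, v1, r, u; split=> //; apply: above_sub H.
by apply/subsetP => q; rewrite !inE => /asboolP /aboveS ?; apply/asboolP.
Qed.

Lemma above_join w E (E1 : {set S}) n m p v1 v2 :
    (forall q, q \in E1 -> above w E m q v2) ->
  above (v2 ++ w) E1 n p v1 -> above w E (n + m) p (v1 ++ v2).
Proof.
move=> E1P; elim: n p v1 => [|n IHn] p v1.
  case=> [[-> /E1P]//|[|//]]; rewrite catA => ?.
  by apply: above0; right; left.
case=> [[-> /E1P]|[|[x [v' [r [u [-> tru /IHn]]]]]]].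
- by apply: above_mono; rewrite leq_addl.
- by rewrite catA => ?; apply: above0; right; left.
by rewrite -catA => ?; right; right; exists x, (v' ++ v2), r, u.
Qed.

(** The iteration count bounds the number of tuples of a state, a top symbol, a class of the rest
    and a set of exit states. One round allows a move and then the treatment of the at most [N]
    symbols written, each in the time of the previous round. *)
Definition pop_time : nat := iter (N * N * I * 2 ^ N) (fun n => (N.+1 * n).+1) 0.

Lemma iter_ge (g : nat -> nat) m n a :
  (forall n, n <= g n) -> m <= n -> iter m g a <= iter n g a.
Proof.
move=> g_ge /subnK <-; elim: (n - m) => // d IHd.
by rewrite addSn iterS (leq_trans IHd) // g_ge.
Qed.

(** The tuples that can be solved within [n] moves form an increasing chain [D n] of finite sets.
    Once it is stable, a word is treated symbol by symbol, each symbol within the stable time. *)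
Lemma above_time w E k p v : 
  above w E k p v -> above w E (pop_time * size v) p v.
Proof.
have [cl clP] := C_index.
have above_cl w1 w2 E1 n q v1 :
    cl w1 = cl w2 -> above w1 E1 n q v1 -> above w2 E1 n q v1.
  move=> e; elim: n q v1 => [|n IHn] q v1.
    by case=> [|[/(clP _ _ e)|]] //; [left | right; left].
  case=> [|[/(clP _ _ e)|]]; [by left | by right; left |].
  case=> x [v' [r [u [-> tru /IHn H]]]]; right; right.
  by exists x, v', r, u.
pose T := (S * G * 'I_I * {set S})%type.
pose D n := [set t : T |
  `[< exists2 w, cl w = t.1.2 & above w t.2 n t.1.1.1 [:: t.1.1.2] >]].
have DP q x w1 E1 n :
    above w1 E1 n q [:: x] <-> (q, x, cl w1, E1) \in D n.
  rewrite inE; split=> [|/asboolP[w2 /= ew H]]; last exact: above_cl ew H.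
  by move=> H; apply/asboolP; exists w1.
have D_mono m n : m <= n -> D m \subset D n.
  by move=> le; apply/subsetP => -[[[q x] e] E1]; rewrite !inE
    => /asboolP[w1 ew H]; apply/asboolP; exists w1 => //; apply: above_mono H.
pose g n := (N.+1 * n).+1.
have g_ge n : n <= g n by rewrite leqW // leq_pmull.
have [i lei sub] := chain_stable D_mono g_ge; set n0 := iter i g 0 in sub.
have le_n0 : n0 <= pop_time.
  apply: iter_ge => //; apply: leq_trans lei _.
  by rewrite !card_prod card_ord !leq_mul // card_set_le.
have word m q w1 E1 u : (forall n, n <= m -> D n \subset D n0) ->
    above w1 E1 m q u -> above w1 E1 (n0 * size u) q u.
  move=> IHm; elim: u q => [|x u IHu] q H.
    apply: above0; case: m H {IHm} => [|m] //= [|[]]; auto.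
    by case=> x [v' [r [u []]]].
  rewrite mulnS; have /DP := above_split (v1 := [:: x]) H.
  move/(subsetP (IHm _ (leqnn m)))/DP; apply: above_join => r.
  by rewrite inE => /asboolP /IHu.
(* After its first move, a solution in [m.+1] moves faces a word of at most [N] symbols, which by
   induction takes at most [n0] moves per symbol. So it fits into [g n0] moves, and [sub] brings
   this back to [n0]. *)
have stable m : D m \subset D n0.
  elim/ltn_ind: m => -[|m] IHm; first exact: D_mono.
  apply/subsetP => -[[[q x] e] E1]; rewrite !inE => /asboolP[w1 /= ew].
  rewrite -ew => H; have : (q, x, cl w1, E1) \in D (g n0).
    apply/DP; case: H => [|[|]]; [by left | by right; left |].
    case=> _ [_ [r [u [[<- <-] tru H]]]]; right; right.
    exists x, [::], r, u; split=> //; rewrite cats0 in H *.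
    apply: (above_mono (m := n0 * size u)); last exact: word H.
    by rewrite mulnC leq_mul // leqW // (tr_size tru).
  by move/(subsetP sub); rewrite inE.
move=> /word H; apply: (above_mono (m := n0 * size v)).
  by rewrite leq_mul.
exact: H.
Qed.

(** At most [N] rounds, one for each state on the empty pushdown; a round is a bottom move followed
    by erasing the at most [N] symbols that it wrote. *)
Definition bottom_time : nat := N * (N * pop_time).+1.

Lemma withinS n c : within C n c -> within C n.+1 c.
Proof.
elim: n c => [|n IHn] c; first by case=> //; left.
by case=> [|[c' st /IHn ?]]; [left | right; exists c'].
Qed.

Lemma within_mono m n c : m <= n -> within C m c -> within C n c.
Proof. by move/subnK <-; elim: (n - m) => // d IHd /IHd /withinS. Qed.

Lemma within_above k p v : within C k (p, v) ->
  above [::] [set q | `[< within C k (q, [::]) >]] k p v.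
Proof.
elim: k p v => [|k IHk] p v; first by case=> //; right; left; rewrite cats0.
case=> [|[c' st H]]; first by right; left; rewrite cats0.
move Ec: (p, v) st => c st; case: st Ec H => [p0 x r u s|p0 r u] tru [-> ->].
  move=> /IHk H; right; right; exists x, s, r, u; split=> //.
  apply: above_sub H; apply/subsetP => q; rewrite !inE => /asboolP /withinS ?.
  exact/asboolP.
move=> H; left; split=> //; rewrite inE; apply/asboolP; right.
by exists (r, u) => //; apply: StepBottom.
Qed.

Lemma above_within (E : {set S}) n m p v : (forall q, q \in E -> within C m (q,
  [::])) ->
  above [::] E n p v -> within C (n + m) (p, v).
Proof.
move=> EP; elim: n p v => [|n IHn] p v.
  case=> [[-> /EP]//|[|//]]; rewrite cats0 => ?.
  by apply: (within_mono (leq0n _)); left.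
case=> [[-> /EP]|[]].
- by apply: within_mono; rewrite leq_addl.
- by rewrite cats0 => ?; left.
case=> x [v' [r [u [-> tru /IHn ?]]]]; right.
by exists (r, u ++ v') => //; apply: StepTop.
Qed.

(** A run is cut where the pushdown is empty: between these points [above_time] applies, and the set
    of states that succeed from the empty pushdown stabilises. *)
Lemma within_time k p v : within C k (p, v) ->
  within C (pop_time * size v + bottom_time) (p, v).
Proof.
pose D n := [set q | `[< within C n (q, [::]) >]].
have D_mono m n : m <= n -> D m \subset D n.
  move=> le; apply/subsetP => q; rewrite !inE => /asboolP H.
  by apply/asboolP; apply: within_mono H.
pose g n := (N * pop_time).+1 + n.
have [i lei sub] := chain_stable (g := g) D_mono (fun n => leq_addl _ n).
set n0 := iter i g 0 in sub.
have le_n0 : n0 <= bottom_time.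
  have ->: n0 = i * (N * pop_time).+1.
    by rewrite /n0; elim: (i) => // i0 /= ->; rewrite mulSn.
  by rewrite leq_mul2r (leq_trans lei) ?orbT.
have word m q u : D m \subset D n0 -> within C m (q, u) ->
    within C (pop_time * size u + n0) (q, u).
  move=> sub_m /within_above /(above_sub sub_m) /above_time.
  by apply: above_within => r; rewrite inE => /asboolP.
have stable m : D m \subset D n0.
  elim: m => [|m IHm]; first exact: D_mono.
  apply/subsetP => q; rewrite inE => /asboolP H.
  apply: (subsetP sub); rewrite inE; apply/asboolP.
  case: H => [|[c' st H]]; first by left.
  right; exists c' => //; move Ec: (q, [::]) st => c st.
  case: st Ec H => // p0 r u tru [_ /(word _ _ _ IHm)]; apply: within_mono.
  by rewrite leq_add2r mulnC leq_mul // (tr_size tru).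
by move/(word _ _ _ (stable k)); apply: within_mono; rewrite leq_add2l.
Qed.

End TimeBound.

(** * Acceptance with a bounded number of flips *)

Section Accept.

Variable F : S -> Prop.

Fixpoint acc j : conf -> Prop :=
  pre (fun c => F c.1 \/ if j is i.+1 then flipped fl (acc i) c else False).

Definition acc_target j c :=
  F c.1 \/ if j is i.+1 then flipped fl (acc i) c else False.

Lemma accE j : acc j = pre (acc_target j). Proof. by case: j. Qed.

Lemma leq_tower_head : 2 ^ N <= 2 ^ (N * N.+1 ^ N).
Proof. by rewrite leq_exp2l // leq_pmulr // expn_gt0. Qed.

Lemma index_orl C n : index_le C n -> index_le (fun c => F c.1 \/ C c) n.
Proof.
by case=> cl clP; exists cl => w w' e p v [|/(clP _ _ e)]; [left | right].
Qed.

Lemma acc_index j : index_le (acc j) (tower N j).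
Proof.
elim: j => [|j IHj]; rewrite accE.
  apply: (index_leW (n := 1 * 2 ^ N)).
    by rewrite leq_mul // leq_tower_head.
  by apply: pre_index; exists (fun _ => ord0) => w w' _ p v [] //; left.
apply: (index_leW (n := 2 ^ (N.+1 * tower N j) * 2 ^ N)).
  by rewrite leq_mul // leq_tower_head.
exact/pre_index/index_orl/flipped_index.
Qed.

Lemma acc_target_index j : index_le (acc_target j) (tower N j).
Proof.
case: j => [|j].
  apply: (index_leW (n := 1)); first by rewrite muln_gt0 expn_gt0.
  by exists (fun _ => ord0) => w w' _ p v [] //; left.
apply: (index_leW (n := 2 ^ (N.+1 * tower N j))).
  by rewrite leq_pmulr // expn_gt0.
exact/index_orl/flipped_index/acc_index.
Qed.

Inductive accept_in : nat -> nat -> conf -> Prop :=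
  | AcceptFinal n j c : F c.1 -> accept_in n j c
  | AcceptStep n j c c' : step c c' -> accept_in n j c' -> accept_in n.+1 j c
  | AcceptFlip n j p q s : fl p q -> accept_in n j (q, rev s) ->
      accept_in n.+1 j.+1 (p, s).

Lemma accept_in_mono m n j c : m <= n -> accept_in m j c -> accept_in n j c.
Proof.
move=> le H; elim: H n le => {m j c}.
- by move=> n j c Fc n' _; apply: AcceptFinal.
- by move=> m j c c' st _ IH [|n] // le; apply: AcceptStep st (IH _ _).
by move=> m j p q s Rpq _ IH [|n] // le; apply: AcceptFlip Rpq (IH _ _).
Qed.

Lemma accept_in_acc n j c : accept_in n j c -> acc j c.
Proof.
elim=> {n j c} [n j c Fc|n j c c' st _|n j p q s Rpq _ H]; rewrite !accE.
- by exists 0; left; left.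
- by case=> m H; exists m.+1; right; exists c'.
by exists 0; left; right; exists q.
Qed.

Lemma acc_accept_in j c : acc j c -> exists n, accept_in n j c.
Proof.
elim: j c => [|j IHj] c; rewrite accE => -[n]; elim: n c => [|n IHn] c.
- by case=> // -[] // Fc; exists 0; apply: AcceptFinal.
- case=> [[] // Fc|[c' st /IHn[m H]]]; first by exists 0; apply: AcceptFinal.
  by exists m.+1; apply: AcceptStep H.
- case=> // -[Fc|]; first by exists 0; apply: AcceptFinal.
  by case: c => p s [q pq /IHj[m H]]; exists m.+1; apply: AcceptFlip H.
case=> [[Fc|]|[c' st /IHn[m H]]]; first by exists 0; apply: AcceptFinal.
  by case: c => p s [q pq /IHj[m H]]; exists m.+1; apply: AcceptFlip H.
by exists m.+1; apply: AcceptStep H.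
Qed.

Lemma acc_leq i j c : i <= j -> acc i c -> acc j c.
Proof.
move=> le_ij /acc_accept_in[n H]; apply: (@accept_in_acc n).
elim: H j le_ij => {n i c} [n i c Fc|n i c c' st _ IH|n i p q s pq _ IH] j le_ij.
- exact: AcceptFinal.
- exact: AcceptStep st (IH _ le_ij).
by case: j le_ij => // j le_ij; apply: AcceptFlip pq (IH _ le_ij).
Qed.

Variable k : nat.
Let P := pop_time (tower N k).
Let B := bottom_time (tower N k).

(** A common bound for height and time. From height [m] a phase without flips needs at most
    [P * m + B] moves, each adding at most [N] to the height; the extra unit in [N.+1] pays for the
    moves themselves, and the successor for the flip. *)
Definition grow m : nat := m + N.+1 * (P * m + B).+1.

Lemma grow_add m d : grow m + d <= grow (m + d).
Proof.
rewrite /grow addnAC leq_add2l leq_mul2l ltnS leq_add2r leq_mul2l leq_addr.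
by rewrite !orbT.
Qed.

(** This lets time already spent be charged to the starting value of the remaining iterations. *)
Lemma iter_grow_add i m d : iter i grow m + d <= iter i grow (m + d).
Proof.
elim: i m d => // i IHi m d; rewrite !iterSr.
apply: leq_trans (IHi _ _) _; have /subnKC <- := grow_add m d.
by apply: leq_trans (IHi _ _); apply: leq_addr.
Qed.

Lemma step_size c c' : step c c' -> size c'.2 <= size c.2 + N.
Proof.
case=> [p x r u s|p r u] /tr_size /= su; last exact: su.
by rewrite size_cat addSn addnC leqW // leq_add2l.
Qed.

Lemma within_accept j n t c : 
    (forall c', acc_target j c' -> size c'.2 <= size c.2 + N * n ->
      accept_in t j c') ->
  within (acc_target j) n c -> accept_in (n + t) j c.
Proof.
move=> H; elim: n c H => [|n IHn] c H.
  by case=> // /H; apply; rewrite muln0 addn0.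
case=> [/H Hc|[c' st Hc']]; last have size_c := step_size st.
  by apply: (accept_in_mono (leq_addl _ _)); apply: Hc; rewrite leq_addr.
apply: (AcceptStep st); apply: (IHn _ _ Hc') => c'' /H; rewrite mulnS addnA => Hc'' le.
by apply: Hc''; apply: leq_trans le _; rewrite leq_add2r size_c.
Qed.

Lemma acc_time j c m : j <= k -> acc j c -> size c.2 <= m ->
  accept_in (iter j.+1 grow m) j c.
Proof.
elim: j c m => [|j IHj] [p s] m lej; rewrite accE => -[n H] /= les.
all: have {H} := within_time (index_leW (leq_tower _ lej) (acc_target_index _)) H.
all: rewrite -/P -/B => H.
  have le1 : P * size s + B <= grow m.
    rewrite /grow; have: P * size s <= P * m by rewrite leq_mul2l les orbT.
    by rewrite mulSn; lia.
  apply: (accept_in_mono le1); rewrite -[X in accept_in X]addn0.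
  by apply: within_accept H => c' [] // Fc' _; apply: AcceptFinal.
(* The moves of the first phase, one flip, and the remaining phases from the height that the first
   phase can have built up. *)
apply: (accept_in_mono (m := (P * m + B) + (iter j.+1 grow (m + N * (P * m + B))).+1)).
  have ->: grow (grow (iter j grow m)) = iter j.+1 grow (grow m).
    by rewrite -iterSr.
  rewrite addnC addSn -addnS.
  apply: leq_trans (iter_grow_add _ _ _) _.
  have le2 : m + N * (P * m + B) + (P * m + B).+1 <= grow m.
    by rewrite /grow mulSn mulnS; lia.
  by rewrite -(subnKC le2); apply: leq_trans (iter_grow_add _ _ _); apply: leq_addr.
apply: within_accept (within_mono _ H) => [c'|]; last first.
  by rewrite leq_add2r leq_mul2l les orbT.
case=> [Fc' _|[q Rq Cq] /= les']; first exact: AcceptFinal.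
case: c' Rq Cq les' => p' s' /= Rq Cq les'.
apply: AcceptFlip Rq (IHj _ _ (ltnW lej) Cq _).
by rewrite size_rev (leq_trans les') // leq_add2r.
Qed.

End Accept.

(** * Forward reachability *)

Variable c0 : S.

(* Exactly [j] flips, whereas [acc] allows at most [j]. *)
Fixpoint reach j : conf -> Prop :=
  post (fun c => if j is i.+1 then flipped (fun q p => fl p q) (reach i) c
                 else c = (c0, [::])).

Lemma reach_index j : index_le (reach j) (tower N j).
Proof.
elim: j => [|j IHj]; last exact/post_index/flipped_index.
(* Only the empty bottom can be completed to the initial configuration; these two classes are the
   factor [2] in [tower N 0]. *)
apply: post_index; apply: (index_fin (cl := fun w => w == [::])).
  by rewrite card_bool.
move=> w w' e p v [-> /nilP]; rewrite cat_nilp => /andP[/nilP-> /nilP ew].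
by move: e; rewrite ew => /esym/eqP ->.
Qed.

End System.

(** * Density is a matter of short words *)

Section Nerode.

Variables (S G J : finType) (I : nat) (A : J -> S * seq G -> Prop).
Hypothesis A_index : forall j, index_le (A j) I.

Definition nerode w w' := forall j p v, A j (p, v ++ w) <-> A j (p, v ++ w').

(** The given classifications may be finer than the Nerode equivalence. Mapping [w] to all values of
    [cl] on its Nerode class makes the kernel exact, hence a congruence for adding symbols on top,
    at the cost of a power set. *)
Lemma nerode_class : exists nc : seq G -> {set {ffun J -> 'I_I}},
  forall w w', nc w = nc w' <-> nerode w w'.
Proof.
have [cl clP] : exists cl : seq G -> {ffun J -> 'I_I},
    forall w w', cl w = cl w' -> nerode w w'.
  have [f fP] := choice A_index.
  exists (fun w => [ffun j => f j w]) => w w' /ffunP e j p v.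
  by have:= e j; rewrite !ffunE => ej; split; apply: fP.
exists (fun w => [set e | `[< exists2 v, nerode w v & cl v = e >]]) => w w'; split.
  move/setP/(_ (cl w)); rewrite !inE => /asbool_impl[|v wv /clP vw].
    by exists w.
  by move=> j p u; rewrite (wv j p u) (vw j p u).
move=> ww'; apply/setP => e; rewrite !inE; apply: asbool_equiv_eq.
by split=> -[v wv <-]; exists v => // j p u; rewrite -?(wv j p u) (ww' j p u) // wv.
Qed.

Lemma nerode_cat u w w' : nerode w w' -> nerode (u ++ w) (u ++ w').
Proof. by move=> ww' j p v; rewrite !catA. Qed.

End Nerode.

(** Two prefixes of a long word have the same value under [f]; since [f] is a right congruence, the
    factor between them can be cut out without changing the value of the word. *)
Lemma pump (A : Type) (T : finType) (f : seq A -> T) (P : seq A -> Prop) :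
    (forall y y' z, f y = f y' -> f (y ++ z) = f (y' ++ z)) ->
    (forall y y', f y = f y' -> P y -> P y') ->
    (forall y, size y < #|T| -> P y) ->
  forall y, P y.
Proof.
move=> f_cat fP Pshort y; have [n] := ubnP (size y).
elim: n y => // n IHn y /ltnSE le_n.
have [/Pshort//|leT] := ltnP (size y) #|T|.
pose g (i : 'I_#|T|.+1) := f (take i y).
have [i [i' [lt_ii' e]]] : exists i i' : 'I_#|T|.+1, i < i' /\ g i = g i'.
  apply: contrapT => no; suff /leq_card : injective g by rewrite card_ord ltnn.
  move=> i i' e; apply/val_inj/eqP; apply: contraT.
  by rewrite neq_ltn => /orP[] lt; case: no; [exists i, i' | exists i', i].
have le_i' : i' <= size y by rewrite (leq_trans _ leT) // -ltnS.
apply: (fP (take i y ++ drop i' y)).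
  by rewrite -[in RHS](cat_take_drop i' y); apply: f_cat.
apply: IHn; apply: leq_trans le_n; rewrite size_cat size_drop size_take.
by case: ifP; lia.
Qed.

Definition switches_of (ds : seq bool) :=
  count (fun d => d.1 != d.2) (zip ds (behead ds)).

Lemma switches_of_cat d1 d2 :
  switches_of d1 + switches_of d2 <= switches_of (d1 ++ d2).
Proof.
rewrite /switches_of; elim: d1 => //= a [|b d1] IH /=;
  first by case: (d2) => //= *; lia.
by move: IH => /=; rewrite -addnA leq_add2l.
Qed.

Lemma switches_of0 ds : switches_of ds = 0 -> exists d, all (eq_op^~ d) ds.
Proof.
rewrite /switches_of; elim: ds => [|a [|b ds] IH] //=; first by exists true.
  by exists a; rewrite /= eqxx.
case: eqP => //= -> /IH[d /= /andP[/eqP-> all_d]].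
by exists d; rewrite eqxx.
Qed.

Section Language.

Variables (Sigma Gamma Q : finType) (M : flip_pda Sigma Gamma Q) (k N : nat).
Hypothesis cardQ : #|Q| <= N.
Hypothesis cardGamma : #|Gamma| <= N.
Hypothesis delta_size : forall t, t \in delta M -> size t.2 <= N.

Local Notation conf := (Q * seq Gamma)%type.

Definition erased p x r u := exists a, (p, a, x, r, u) \in delta M.
Definition flip_rel p q : Prop := (p, q) \in flips M.

Local Notation reachM := (reach erased flip_rel (init M)).
Local Notation accM := (acc erased flip_rel (fun q => q \in final M)).

Lemma erased_size p x r u : erased p x r u -> size u <= N.
Proof. by case=> a /delta_size. Qed.

Inductive lstep : option Sigma -> conf -> conf -> Prop :=
  | LStepTop p a x r u s : (p, a, Some x, r, u) \in delta M ->
      lstep a (p, x :: s) (r, u ++ s)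
  | LStepBottom p a r u : (p, a, None, r, u) \in delta M ->
      lstep a (p, [::]) (r, u).

Lemma lstep_step a c c' : lstep a c c' -> step erased c c'.
Proof.
by case=> *; [apply: StepTop | apply: StepBottom]; eexists; eassumption.
Qed.

Lemma step_lstep c c' : step erased c c' -> exists a, lstep a c c'.
Proof. by case=> [p x r u s|p r u] [a H]; exists a; constructor. Qed.

Lemma lstep_move a c c' w : lstep a c c' ->
  move M (c.1, ocons a w, c.2) (c'.1, w, c'.2).
Proof. by case=> *; constructor. Qed.

Lemma move_lstep c c' : move M c c' ->
  exists2 a, c.1.2 = ocons a c'.1.2 & lstep a (c.1.1, c.2) (c'.1.1, c'.2).
Proof. by case=> [p a x r u w s|p a r u w] H; exists a => //; constructor. Qed.

Definition monotone (up : bool) (c c' : conf) :=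
  if up then size c.2 <= size c'.2 else size c'.2 <= size c.2.

Inductive run up : seq Sigma -> conf -> conf -> Prop :=
  | RunNil c : run up [::] c c
  | RunStep a y c c' c'' : lstep a c c' -> monotone up c c' ->
      run up y c' c'' -> run up (ocons a y) c c''.

Lemma run_cat up y1 y2 c c1 c2 :
  run up y1 c c1 -> run up y2 c1 c2 -> run up (y1 ++ y2) c c2.
Proof.
elim=> {y1 c c1} // a y1 c c' c1 st mn _ IH /IH.
by case: a st => [a|] st /(RunStep st mn).
Qed.

Lemma run_split up y1 y2 c c2 : run up (y1 ++ y2) c c2 ->
  exists2 c1, run up y1 c c1 & run up y2 c1 c2.
Proof.
move Ey: (y1 ++ y2) => y H; elim: H y1 Ey => {y c c2}.
  by move=> c [|? ?] //= ->; exists c; constructor.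
move=> a y c c' c2 st mn H IH [|b y1].
  by move=> /= ->; exists c; [constructor | apply: RunStep H].
case: a st => [a|] st /=; last first.
  move=> Ey; have [c1 H1 H2] := IH (b :: y1) Ey.
  by exists c1 => //; apply: (RunStep st mn).
case=> -> /IH[c1 H1 H2]; exists c1 => //.
exact: (RunStep (a := Some a) st mn).
Qed.

(* The word [y] is read without flips during a rising or a falling phase of an
   accepting computation. *)
Definition phase_word (y : seq Sigma) : Prop :=
  exists up i j c c', [/\ i + j <= k, reachM i c, run up y c c' & accM j c'].

(** * Monotone runs on abstract configurations *)

Section Abstraction.

Variable T : finType.
Variable A : 'I_k.+1 -> conf -> Prop.
Variable nc : seq Gamma -> T.
Hypothesis ncP : forall w w', nc w = nc w' <-> nerode A w w'.

Definition abs (c : conf) := (c.1, ohead c.2, nc (behead c.2)).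

Lemma abs_cons p x s q y s' : abs (p, x :: s) = abs (q, y :: s') ->
  [/\ p = q, x = y & nerode A s s'].
Proof. by case=> -> -> /ncP. Qed.

Lemma abs_nerode c c' : abs c = abs c' -> c.1 = c'.1 /\ nerode A c.2 c'.2.
Proof.
case: c c' => p [|x s] [p' [|x' s']] //; first by case=> ->.
by case=> <- <- /ncP ss'; split=> //; apply: (nerode_cat [:: x] ss').
Qed.

Lemma abs_ext p u s s' : nerode A s s' -> abs (p, u ++ s) = abs (p, u ++ s') \/ u =
  [::].
Proof.
case: u => [|x u] ss'; [by right | left; congr (_, _, _)].
exact/ncP/nerode_cat.
Qed.

(** A rising run never erases its top symbol without replacement, so the symbols below the top are
    never uncovered and the run can be copied forward over any equivalent rest. *)
Lemma run_up_abs y c c' d : run true y c c' -> abs c = abs d ->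
  exists2 d', run true y d d' & abs c' = abs d'.
Proof.
move=> H; elim: H d => {y c c'} [c d e|a y c c' c'' st]; first by exists d;
  first constructor.
move=> mn _ IH d e.
suff [d' [st' mn' /IH[d'' H e']]] : exists d', [/\ lstep a d d', monotone true d d'
  & abs c' = abs d'].
  by exists d'' => //; apply: RunStep H.
case: st mn e => [p {}a x r u s|p {}a r u] tr /=; last first.
  by case: d => q [|? ?] // _ [<-]; exists (r, u); split=> //; apply: LStepBottom.
case: d => q [|x' s'] // mn /abs_cons[<- <- ss']; exists (r, u ++ s'); split.
- exact: LStepTop.
- by move: mn; rewrite /= !size_cat; lia.
by case: (abs_ext r u ss') => // u0; move: mn; rewrite u0 ltnn.
Qed.

(** Backward, a falling run only replaces the top or adds one symbol, because each of its moves
    writes at most one symbol over the one it removes. So it can be copied from its end. *)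
Lemma run_down_abs y c c' d' : run false y c c' -> abs c' = abs d' ->
  exists2 d, run false y d d' & abs c = abs d.
Proof.
move=> H; elim: H d' => {y c c'} [c d e|a y c c' c'' st]; first by exists d;
  first constructor.
move=> mn _ IH d'' /IH[d' H e].
suff [d [st' mn' e']] : exists d, [/\ lstep a d d', monotone false d d' & abs c =
  abs d].
  by exists d => //; apply: RunStep H.
case: st mn e => [p {}a x r u s|p {}a r u] tr /=; last first.
  case: u tr => // tr _; case: d' {H IH} => q [|? ?] // [<-].
  by exists (p, [::]); split=> //; constructor.
rewrite size_cat => su.
case: u tr su => [|z [|z' u]] tr su /=; last by move: su => /=; lia.
  case/abs_nerode; case: d' {H IH} => q s' /= <- ss'; exists (p, x :: s'); split=> //.
  - exact: (LStepTop _ tr).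
  - by congr (_, _, _); apply/ncP.
case: d' {H IH} => q [|z' s'] // /abs_cons[<- <- ss']; exists (p, x :: s'); split=> //.
- exact: (LStepTop _ tr).
- by congr (_, _, _); apply/ncP.
Qed.

Definition run_abs up y := [set e |
  `[< exists c c', [/\ run up y c c', abs c = e.1 & abs c' = e.2] >]].

Lemma run_absP up y c c' : run up y c c' -> (abs c, abs c') \in run_abs up y.
Proof. by move=> H; rewrite inE; apply/asboolP; exists c, c'. Qed.

(** The replacement for the first run meets the second one only up to abstraction; forward copying
    makes the second run start where the replacement ends. *)
Lemma run_abs_up_cat y y' z : run_abs true y = run_abs true y' ->
  run_abs true (y ++ z) \subset run_abs true (y' ++ z).
Proof.
move=> e; apply/subsetP => -[a b]; rewrite inE => /asboolP[c [c2 [+ /= <- <-]]].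
case/run_split => c1 /run_absP; rewrite e inE.
move=> /asboolP[d [d1 [H1 /= ed ed1]]] /run_up_abs /(_ (esym ed1)) [d2 H2 ->].
by rewrite -ed run_absP //; apply: run_cat H2.
Qed.

(** Dual to the rising case: the replacement for the first run is copied backward from the start of
    the second. *)
Lemma run_abs_down_cat y y' z : run_abs false y = run_abs false y' ->
  run_abs false (y ++ z) \subset run_abs false (y' ++ z).
Proof.
move=> e; apply/subsetP => -[a b]; rewrite inE => /asboolP[c [c2 [+ /= <- <-]]].
case/run_split => c1 /run_absP; rewrite e inE.
move=> /asboolP[d [d1 [/run_down_abs + /= <- ed1]]] H2.
by case/(_ _ ed1) => d' H1 ->; rewrite run_absP //; apply: run_cat H2.
Qed.

End Abstraction.


(** States, optional top symbols, and sets of functions from the [k.+1] numbers of flips to classes,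
    as in [nerode_class]. *)
Definition abs_card := N * N.+1 * 2 ^ (tower N k ^ k.+1).
Definition run_abs_card := 2 ^ (abs_card * abs_card).

(** Being a phase word depends only on two abstract relations. A rising run is replaced with its
    start fixed, and acceptance passes to the new end; a falling one with its end fixed, and
    reachability passes to the new start. Hence rising runs use the classes of [accM] and falling
    runs those of [reachM]. *)
Lemma phase_word_short :
    (forall y, size y < run_abs_card * run_abs_card -> phase_word y) ->
  forall y, phase_word y.
Proof.
have [j|nf nfP] := @nerode_class _ _ 'I_k.+1 (tower N k) (fun j => accM j).
  apply: (index_leW _ (acc_index _ _ cardQ _ _)).
  by apply: leq_tower; rewrite -ltnS.
have [j|nb nbP] := @nerode_class _ _ 'I_k.+1 (tower N k) (fun j => reachM j).
  apply: (index_leW _ (reach_index _ cardQ cardGamma erased_size _ _)).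
  by apply: leq_tower; rewrite -ltnS.
pose f y := (run_abs nf true y, run_abs nb false y).
move=> Pshort; apply: (pump (f := f)) => [y y' z [eu ed]|y y' [eu ed]|y lty].
- by congr (_, _); apply/eqP; rewrite eqEsubset;
    rewrite !(run_abs_up_cat nfP, run_abs_down_cat nbP).
- case=> up [i [j [c [c' [le_k Rc]]]]].
  have [lti ltj] : i < k.+1 /\ j < k.+1 by lia.
  case: up => + Ac'.
    move/(run_absP nf); rewrite eu inE => /asboolP[d [d' [+ /= ed0 ed']]].
    case/(run_up_abs nfP)/(_ ed0) => c1 H e.
    exists true, i, j, c, c1; split=> //.
    have := abs_nerode nfP (etrans (esym ed') e).
    case: c' c1 Ac' {H e ed'} => p s [_ s1] /= Ac' [<- /(_ (Ordinal ltj) p [::])].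
    by case=> + _; apply.
  move/(run_absP nb); rewrite ed inE => /asboolP[d [d' [+ /= ed0 ed']]].
  case/(run_down_abs nbP)/(_ ed') => c1 H e.
  exists false, i, j, c1, c'; split=> //.
  have := abs_nerode nbP (etrans (esym ed0) e).
  case: c c1 Rc {H e ed0} => p s [_ s1] /= Rc [<- /(_ (Ordinal lti) p [::])].
  by case=> + _; apply.
apply: Pshort; apply: leq_trans lty _.
rewrite card_prod !card_set_of !card_prod !card_set_of card_ffun !card_ord card_option.
have le_abs : #|Q| * #|Gamma|.+1 * 2 ^ (tower N k ^ k.+1) <= abs_card.
  by rewrite !leq_mul.
by rewrite leq_mul // leq_exp2l // leq_mul.
Qed.

(** * Gluing and cutting computations *)

Lemma computation_cat c1 n1 hs1 c2 n2 hs2 c3 :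
    computation M c1 n1 hs1 c2 -> computation M c2 n2 hs2 c3 ->
  exists hs, computation M c1 (n1 + n2) hs c3.
Proof.
move=> H H2; elim: H H2 => {c1 n1 hs1 c2} [c|c1 c2 c n hs mv _ IH|p q w s c n hs pq
  _ IH].
- by exists hs2.
- by case/IH => hs' ?; exists (height c1 :: hs'); apply: CompMove mv _.
by case/IH => hs' ?; exists (size s :: hs'); apply: CompFlip pq _.
Qed.

(** The word read is chosen before the remaining input [w], so that pieces can be concatenated. *)
Lemma step_computation c c' : step erased c c' -> exists x, forall w, exists hs,
  computation M (c.1, x ++ w, c.2) 0 hs (c'.1, w, c'.2).
Proof.
case/step_lstep => a st; exists (ocons a [::]) => w; eexists.
apply: (CompMove _ (CompNil _ _)).
by have -> : ocons a [::] ++ w = ocons a w; [case: (a) | apply: lstep_move].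
Qed.

Lemma computation_trans_word (c c1 c' : conf) n1 n2 :
    (exists x, forall w, exists hs,
      computation M (c.1, x ++ w, c.2) n1 hs (c1.1, w, c1.2)) ->
    (exists x, forall w, exists hs,
      computation M (c1.1, x ++ w, c1.2) n2 hs (c'.1, w, c'.2)) ->
  exists x, forall w, exists hs,
    computation M (c.1, x ++ w, c.2) (n1 + n2) hs (c'.1, w, c'.2).
Proof.
case=> x1 H1 [x2 H2]; exists (x1 ++ x2) => w.
have [hs1 C1] := H1 (x2 ++ w); have [hs2 C2] := H2 w.
by rewrite -catA; apply: computation_cat C1 C2.
Qed.

Lemma flip_computation p q s : flip_rel p q -> exists x, forall w, exists hs,
  computation M (p, x ++ w, s) 1 hs (q, w, rev s).
Proof.
move=> pq; exists [::] => w; eexists.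
by apply: CompFlip pq _; apply: CompNil.
Qed.

Lemma reach_computation i c : reachM i c -> exists x, forall w, exists hs,
  computation M (init M, x ++ w, [::]) i hs (c.1, w, c.2).
Proof.
elim: i c => [|i IHi] c /=; elim=> {c} [c|c c' _ IH st].
- by move=> ->; exists [::] => w; eexists; apply: CompNil.
- by rewrite -[0]addn0; apply: (@computation_trans_word (_, _)) IH
  (step_computation st).
- case: c => q s [p pq /IHi H]; rewrite -addn1.
  apply: (@computation_trans_word (_, _) _ (_, _)) H _.
  by have := flip_computation (rev s) pq; rewrite revK.
by rewrite -[i.+1]addn0; apply: (@computation_trans_word (_, _)) IH
  (step_computation st).
Qed.

Lemma acc_computation j c : accM j c -> exists n q s z hs,
  [/\ n <= j, q \in final M & computation M (c.1, z, c.2) n hs (q, [::], s)].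
Proof.
have fin j' (c1 : conf) : c1.1 \in final M -> exists n' q s z hs,
    [/\ n' <= j', q \in final M & computation M (c1.1, z, c1.2) n' hs (q, [::], s)].
  move=> Fc1; exists 0, c1.1, c1.2, [::], [:: size c1.2]; split=> //.
  exact: (CompNil M (c1.1, [::], c1.2)).
have ext n1 j1 j2 (c1 c2 : conf) : n1 + j1 <= j2 ->
    (exists x, forall w, exists hs,
      computation M (c1.1, x ++ w, c1.2) n1 hs (c2.1, w, c2.2)) ->
    (exists n q s z hs, [/\ n <= j1, q \in final M
      & computation M (c2.1, z, c2.2) n hs (q, [::], s)]) ->
    exists n q s z hs, [/\ n <= j2, q \in final M
      & computation M (c1.1, z, c1.2) n hs (q, [::], s)].
  move=> le12 [x Hx] [n [q [s [z [hs [len Fq Cz]]]]]].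
  have [hs1 C1] := Hx z; have [hs' C'] := computation_cat C1 Cz.
  by exists (n1 + n), q, s, (x ++ z), hs'; split=> //; lia.
elim: j c => [|j IHj] c; rewrite accE => -[m]; elim: m c => [|m IHm] c /=.
- by case=> // -[] // /fin.
- case=> [[] // /fin //|[c' st /IHm]].
  by apply: ext (step_computation st); rewrite add0n.
- case=> // -[/fin //|[q pq /IHj]].
  by case: c pq => p s /flip_computation H; apply: (ext _ _ _ (p, s) (q, rev s)) (H s).
case=> [[/fin //|[q pq /IHj]]|[c' st /IHm]].
  by case: c pq => p s /flip_computation H; apply: (ext _ _ _ (p, s) (q, rev s)) (H s).
by apply: ext (step_computation st); rewrite add0n.
Qed.

Lemma run_computation up y c c' : run up y c c' -> forall w, exists hs,
  computation M (c.1, y ++ w, c.2) 0 hs (c'.1, w, c'.2).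
Proof.
elim=> {y c c'} [c w|a y c c' c'' /lstep_move mv _ _ IH w].
  by exists [:: size c.2]; apply: (CompNil M (c.1, w, c.2)).
have [hs H] := IH w; exists (size c.2 :: hs).
by apply: CompMove H; have -> : ocons a y ++ w = ocons a (y ++ w) by case: (a).
Qed.

Lemma phase_word_infix y : phase_word y -> infixes (language M k) y.
Proof.
case=> up [i [j [c [c' [le_k /reach_computation[x Hx]]]]]].
move=> /run_computation Hy /acc_computation[n [q [s [z [hs [len Fq Hz]]]]]].
have [hs1 H1] := Hx (y ++ z); have [hs2 H2] := Hy z.
have [hs3 H3] := computation_cat H1 H2; have [hs4 H4] := computation_cat H3 Hz.
by exists x, z, hs4, (i + 0 + n), q, s; split=> //; lia.
Qed.

Lemma computation_reach c n hs c' : computation M c n hs c' ->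
  forall i, reachM i (c.1.1, c.2) -> reachM (i + n) (c'.1.1, c'.2).
Proof.
elim=> {c n hs c'} [c i|c1 c2 c n hs mv _ IH i H|p q w s c n hs pq _ IH i H].
- by rewrite addn0.
- apply: IH; case: i H => [|i] H; apply: PostStep H _.
    by have [a _ /lstep_step] := move_lstep mv.
  by have [a _ /lstep_step] := move_lstep mv.
by rewrite addnS -addSn; apply: IH; apply: PostRefl; exists p; rewrite //= revK.
Qed.

Lemma computation_acc c n hs c' : computation M c n hs c' ->
  c'.1.1 \in final M -> accM n (c.1.1, c.2).
Proof.
elim=> {c n hs c'} [c Fc|c1 c2 c n hs mv _ IH Fc|p q w s c n hs pq _ IH Fc].
- by exists 0; left; left.
- have [a _ /lstep_step st] := move_lstep mv; have := IH Fc.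
  by rewrite accE => -[m H]; exists m.+1; right; exists (c2.1.1, c2.2).
by exists 0; left; right; exists q => //; apply: IH.
Qed.

(** Cutting a computation repeats the height at the cut in both parts. The lists of heights then do
    not concatenate, but the lists of consecutive pairs do. *)
Definition pairs (hs : seq nat) := zip hs (behead hs).

Lemma computation_hd c n hs c' : computation M c n hs c' ->
  exists hs', hs = height c :: hs'.
Proof. by case=> *; eexists; rewrite /height. Qed.

Lemma computation_split c n hs c' x w : computation M c n hs c' ->
    c.1.2 = x ++ w -> c'.1.2 = [::] ->
  exists p1 s1 n1 n2 hs1 hs2,
    [/\ computation M c n1 hs1 (p1, w, s1), computation M (p1, w, s1) n2 hs2 c',
     n = n1 + n2 & pairs hs = pairs hs1 ++ pairs hs2].
Proof.
move=> H; elim: H x => {c n hs c'} [c x|c1 c2 c n hs mv H IH x|p q w' s c n hs pq H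
  IH x].
- move=> + c0; rewrite c0; case: x w => // -[] // _; move: c0;
  case: c => [[p ?] s] /= ->.
  exists p, s, 0, 0, [:: size s], [:: size s].
  by split=> //; apply: (CompNil M (p, [::], s)).
- move=> Ex c0; case: x Ex => [|b x] Ex.
    exists c1.1.1, c1.2, 0, n, [:: height c1], (height c1 :: hs).
    have Ec : (c1.1.1, w, c1.2) = c1 by case: c1 Ex {mv} => -[? ?] ? /= ->.
    by rewrite Ec; split=> //; [apply: CompNil | apply: CompMove H].
  have [a Ea _] := move_lstep mv; move: Ea; rewrite Ex => Ea.
  have [x' Ex'] : exists x', c2.1.2 = x' ++ w.
    by case: a Ea => [a /= [_ <-]|/= <-]; [exists x | exists (b :: x)].
  have [p1 [s1 [n1 [n2 [hs1 [hs2 [H1 H2 -> E]]]]]]] := IH _ Ex' c0.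
  exists p1, s1, n1, n2, (height c1 :: hs1), hs2; split=> //.
    by apply: CompMove H1.
  have [hs' Ehs] := computation_hd H; have [hs1' Ehs1] := computation_hd H1.
  by move: E; rewrite Ehs Ehs1 /pairs /= => ->.
move=> /= Ex /(IH x Ex)[p1 [s1 [n1 [n2 [hs1 [hs2 [H1 H2 -> E]]]]]]].
exists p1, s1, n1.+1, n2, (size s :: hs1), hs2; split=> //.
  by apply: CompFlip H1.
have [hs' Ehs] := computation_hd H; have [hs1' Ehs1] := computation_hd H1.
by move: E; rewrite Ehs Ehs1 /pairs /= => ->.
Qed.

Lemma switches_cat hs hs1 hs2 : pairs hs = pairs hs1 ++ pairs hs2 ->
  switches hs1 + switches hs2 <= switches hs.
Proof.
rewrite /switches /directions => E; rewrite -/(switches_of _) -/(switches_of _).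
rewrite -/(pairs hs) E filter_cat map_cat.
exact: switches_of_cat.
Qed.

Lemma computation_run c n hs c' : computation M c n hs c' -> n = 0 ->
    switches hs = 0 ->
  exists up y, c.1.2 = y ++ c'.1.2 /\ run up y (c.1.1, c.2) (c'.1.1, c'.2).
Proof.
move=> H n0 /switches_of0[up]; rewrite all_map all_filter -/(pairs hs) => all_up.
exists up; elim: H n0 all_up => {c n hs c'} // [c|c1 c2 c n hs mv H IH].
  by exists [::]; split=> //; constructor.
move=> n0; have [hs' Ehs] := computation_hd H; rewrite Ehs /pairs /= -/(pairs _).
rewrite -Ehs => /andP[mn /(IH n0)[y [Ey Hy]]].
have [a Ea st] := move_lstep mv; exists (ocons a y); split.
  by rewrite Ea Ey; case: (a).
apply: RunStep st _ Hy; rewrite /monotone /= -/(height _) -/(height _).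
by case: (up) mn; rewrite /=; lia.
Qed.

(** The part of the computation reading one copy of [y] must contain a flip or a switch, since
    otherwise it would exhibit [y] as a phase word. Flips and switches of successive parts add
    up. *)
Lemma repeated_word y m c n hs c' z i :
    ~ phase_word y -> computation M c n hs c' ->
    c.1.2 = flatten (nseq m y) ++ z -> c'.1.2 = [::] -> c'.1.1 \in final M ->
    reachM i (c.1.1, c.2) -> i + n <= k ->
  m <= n + switches hs.
Proof.
move=> not_y; elim: m c n hs i => // m IHm c n hs i H;
  rewrite /= -catA => Ec Ec' Fc' Rc le_k.
have [p1 [s1 [n1 [n2 [hs1 [hs2 [H1 H2 En /switches_cat Ehs]]]]]]] :=
  computation_split H Ec Ec'.
have R1 := computation_reach H1 Rc; have A1 := computation_acc H2 Fc'.
have := IHm _ _ _ _ H2 erefl Ec' Fc' R1; have : 0 < n1 + switches hs1; last by lia.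
rewrite lt0n addn_eq0; apply/negP => /andP[/eqP n10 /eqP sw0].
have [up [y' [/= Ey Hy]]] := computation_run H1 n10 sw0; case: not_y.
exists up, i, n2, (c.1.1, c.2), (p1, s1); split=> //; first by lia.
suff -> : y = y' by [].
have: y ++ (flatten (nseq m y) ++ z) = y' ++ (flatten (nseq m y) ++ z) by rewrite -Ec.
move=> E; have szy : size y = size y' by move/(congr1 size): E; rewrite !size_cat; lia.
by move/eqP: E; rewrite eqseq_cat // => /andP[/eqP].
Qed.

Lemma dense_short l : reversal_bound M k l ->
    (forall y, size y <= (k + l).+1 * (run_abs_card * run_abs_card) ->
      infixes (language M k) y) ->
  dense (language M k).
Proof.
move=> rev_l short y; apply: phase_word_infix; move: y.
apply: phase_word_short => y lty; apply: contrapT => not_y.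
(* At most [k] flips and [l] switches are available, one too few for the copies of [y]. *)
have [|x [z [hs acc_hs]]] := short (flatten (nseq (k + l).+1 y)).
  by rewrite size_flatten /shape map_nseq sumn_nseq mulnC leq_mul2l ltnW ?orbT.
have := rev_l _ _ acc_hs; case: acc_hs => n [q [s [len Fq H]]].
have [p1 [s1 [n1 [n2 [hs1 [hs2 [H1 H2 En /switches_cat Ehs]]]]]]] :=
  computation_split H erefl erefl.
have R1 : reachM (0 + n1) (p1, s1) by apply: computation_reach H1 0 _; apply: PostRefl.
have := repeated_word not_y H2 erefl erefl Fq R1; lia.
Qed.

End Language.

(** * The product with the positions of a word *)

Section Infix.

Variables (Sigma Gamma Q : finType) (M : flip_pda Sigma Gamma Q) (k : nat).
Variable y : seq Sigma.

Local Notation state := (Q * 'I_(size y).+1)%type.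

(* Position [0] stands for a prefix before [y] and [size y] for a suffix after
   [y], so that at both ends any letter may be read without moving. *)
Definition reads (a : option Sigma) i i' : bool :=
  (i' == i) && [|| a == None, i == 0 | i == size y]
  || [&& i' == i.+1, i < size y & a == onth y i].

Definition tracked (p : state) x (r : state) u : Prop :=
  exists2 a, (p.1, a, x, r.1, u) \in delta M & reads a p.2 r.2.

Definition tracked_flip (p r : state) : Prop := (p.1, r.1) \in flips M /\ p.2 = r.2.

Definition tracked_final (p : state) : Prop := p.1 \in final M /\ p.2 = ord_max.

Lemma ocons_onth (T : Type) (w : seq T) i :
  i < size w -> ocons (onth w i) (drop i.+1 w) = drop i w.
Proof. by elim: w i => //= b w IHw [|i] //=; rewrite ?drop0 // => /IHw. Qed.

Lemma ocons_cat (T : Type) a (u v : seq T) : ocons a u ++ v = ocons a (u ++ v).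
Proof. by case: a. Qed.

Lemma reads_sound a i i' x z : reads a i i' -> (i' != 0 -> x = [::]) ->
  exists x' z', (i != 0 -> x' = [::]) /\
    ocons a (x ++ drop i' y ++ z) = x' ++ drop i y ++ z'.
Proof.
move=> /orP[/andP[/eqP-> /or3P[/eqP->|/eqP->|/eqP ->]]|].
- by exists x, z.
- by exists (ocons a x), z; rewrite ocons_cat.
(* For empty [y] the positions [0] and [size y] coincide and [x] need not be empty, so the letter
   goes to the prefix; otherwise it goes to the suffix. *)
- move=> x0; exists (if size y == 0 then ocons a x else [::]).
  exists (if size y == 0 then z else ocons a z).
  rewrite drop_oversize //=; case: eqP x0 => [|_ /(_ isT) ->] //=.
  by rewrite ocons_cat.
case/and3P => /eqP -> lti /eqP -> /(_ isT) ->.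
by exists [::], z; split=> //; rewrite /= -[drop i y]ocons_onth // ocons_cat.
Qed.

Lemma reads_complete a i w x z : i <= size y -> (i != 0 -> x = [::]) ->
    ocons a w = x ++ drop i y ++ z ->
  exists i' x' z', [/\ i' <= size y, reads a i i', i' != 0 -> x' = [::]
    & w = x' ++ drop i' y ++ z'].
Proof.
rewrite /reads; case: a => [a|] le_i x0 /= E; last first.
  by exists i, x, z; rewrite eqxx.
case: x x0 E => [_|b x] /=.
  case: (ltngtP i (size y)) le_i => // [lti _|-> _].
    rewrite -ocons_onth //; case E: (onth y i) => [b|] /=; last first.
      by have := onthTE y i; rewrite E lti.
    by case=> -> ->; exists i.+1, [::], z; rewrite !eqxx orbT.
  rewrite drop_size; case: z => //= b z [_ ->].
  by exists (size y), [::], z; rewrite drop_size; split=> //; rewrite !eqxx !orbT.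
move=> x0 [-> ->]; have i0 : i = 0 by case: (i) x0 => // j /(_ isT).
by exists 0, x, z; rewrite i0.
Qed.

Local Notation acc_tracked := (acc tracked tracked_flip tracked_final).

Lemma tracked_computation n j c : accept_in tracked tracked_flip tracked_final n j c ->
  exists x z m hs q s, [/\ m <= j, (c.1.2 != ord0 -> x = [::]), q \in final M
    & computation M (c.1.1, x ++ drop c.1.2 y ++ z, c.2) m hs (q, [::], s)].
Proof.
elim=> {n j c} [n j [[p i] s] [/= Fp ->]|n j c c' st _|n j [p i] [q i'] s [/= pq ->] _].
- exists [::], [::], 0, [:: size s], p, s; split=> //.
  by rewrite drop_size; apply: (CompNil M (p, [::], s)).
- case=> x [z [m [hs [q [s [lem x0 Fq H]]]]]].
  case: st x0 H => [[p i] b [r i'] u t|[p i] [r i'] u] [a /= tr] /reads_sound rd x0 H.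
    have [x' [z' [x0' E]]] := rd x z x0.
    exists x', z', m, (height (p, ocons a (x ++ drop i' y ++ z), b :: t) :: hs), q,
      s; split=> //.
    by rewrite -E; apply: CompMove H; apply: MoveTop.
  have [x' [z' [x0' E]]] := rd x z x0.
  exists x', z', m, (height (p, ocons a (x ++ drop i' y ++ z), [::] : seq Gamma) ::
    hs), q, s; split=> //.
  by rewrite -E; apply: CompMove H; apply: MoveBottom.
case=> x [z [m [hs [q' [s' [lem x0 Fq H]]]]]].
exists x, z, m.+1, (size s :: hs), q', s'; split=> //.
exact: CompFlip H.
Qed.

Lemma computation_tracked c n hs c' : computation M c n hs c' ->
    c'.1.1 \in final M -> c'.1.2 = [::] ->
  forall (i : 'I_(size y).+1) x z, c.1.2 = x ++ drop i y ++ z ->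
    (i != 0 :> nat -> x = [::]) ->
  acc_tracked n ((c.1.1, i), c.2).
Proof.
elim=> {c n hs c'} [c Fc c0|c1 c2 c n hs mv _ IH Fc c0|p q w s c n hs pq _ IH Fc
  c0] i x z E x0.
(* No input is left, so [drop i y] is empty and [i] is the last position. *)
- exists 0; left; left; split=> //; apply: val_inj => /=; apply/eqP.
  have := congr1 size E; rewrite c0 !size_cat size_drop.
  by have := ltn_ord i; rewrite ltnS eqn_leq => ->; rewrite /=; lia.
- have [i' [x' [z' [lti rd x0' E']]]] : exists i' x' z', [/\ i' < (size y).+1,
      exists2 a, lstep M a (c1.1.1, c1.2) (c2.1.1, c2.2) & reads a i i',
      i' != 0 -> x' = [::] & c2.1.2 = x' ++ drop i' y ++ z'].
    have [a Ea st] := move_lstep mv.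
    have lei : i <= size y by rewrite -ltnS.
    have [|i' [x' [z' [le' rd x0' E']]]] := @reads_complete a _ c2.1.2 x z lei x0.
      by rewrite -Ea.
    by exists i', x', z'; split=> //; exists a.
  have := IH Fc c0 (Ordinal lti) x' z' E' x0'; rewrite !accE => -[m H].
  exists m.+1; right; exists ((c2.1.1, Ordinal lti), c2.2) => //.
  case: rd => a; move: (c1.1.1) (c1.2) (c2.1.1) (c2.2) => p s r t st.
  move E1: (p, s) st => d1; move E2: (r, t) => d2 st.
  case: st E1 E2 => [p0 {}a b r0 u s0|p0 {}a r0 u] tr [-> ->] [-> ->] rd.
    by apply: (@StepTop _ _ tracked (p0, i) b (r0, Ordinal lti) u s0); exists a.
  by apply: (@StepBottom _ _ tracked (p0, i) (r0, Ordinal lti) u); exists a.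
exists 0; left; right; exists (q, i) => //; exact: IH E x0.
Qed.

Lemma infixes_tracked :
  infixes (language M k) y <-> acc_tracked k ((init M, ord0), [::]).
Proof.
split=> [[x [z [hs [n [q [s [len Fq H]]]]]]]|].
  apply: acc_leq len _.
  by have := computation_tracked H Fq erefl (i := ord0) (x := x) (z := z); apply;
    rewrite /= ?drop0.
case/acc_accept_in => n /tracked_computation /= [x [z [m [hs [q [s [lem _ Fq H]]]]]]].
by exists x, z, hs, m, q, s; split=> //; rewrite drop0 in H.
Qed.

End Infix.

(** * Primitive recursion *)

(** The arguments form an environment with de Bruijn indices: a binder conses its variable, and
    variables are read by [head 0] after some [behead]. *)
Definition computable n (F : seq nat -> nat) : Prop :=
  exists f : recfun n, forall v : n.-tuple nat, computes f v (F v).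

Lemma computable_comp m n (F : seq nat -> nat) (gs : 'I_m -> seq nat -> nat) :
    computable m F -> (forall i, computable n (gs i)) ->
  computable n (fun e => F [seq gs i e | i <- enum 'I_m]).
Proof.
case=> f fP /choice[g gP]; exists (RComp f g) => v.
exists (map_tuple (gs^~ v) (ord_tuple m)) => [i|]; last exact: fP.
by rewrite tnth_map tnth_ord_tuple; apply: gP.
Qed.

Lemma computable_nth n i : i < n -> computable n (nth 0 ^~ i).
Proof. by move=> lt_in; exists (RProj (Ordinal lt_in)) => v;
  rewrite /= (tnth_nth 0). Qed.

Lemma computable_ext n (F F' : seq nat -> nat) : (forall v : n.-tuple nat, F v = F'
  v) ->
  computable n F -> computable n F'.
Proof. by move=> e [f fP]; exists f => v; rewrite -e. Qed.

Lemma computable_behead n F : computable n F -> computable n.+1 (fun e => F (behead e)).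
Proof.
move=> cF; have := computable_comp cF (fun i : 'I_n => computable_nth (ltn_ord
  (lift ord0 i))).
apply: computable_ext => v; congr F; apply: (@eq_from_nth _ 0) => [|i].
  by rewrite size_map size_enum_ord size_behead size_tuple.
rewrite size_map size_enum_ord => lt_in.
by rewrite (nth_map (Ordinal lt_in)) ?size_enum_ord // lift0 nth_enum_ord // nth_behead.
Qed.

Lemma computable_head n : computable n.+1 (head 0).
Proof. by apply: computable_ext (computable_nth (ltn0Sn n)) => v; rewrite nth0. Qed.

Lemma computable_succ n F : computable n F -> computable n (fun e => (F e).+1).
Proof.
have cS : computable 1 (fun e => (head 0 e).+1).
  by exists RSucc => v; rewrite /= /thead (tnth_nth 0) nth0.
by move=> cF; have := computable_comp cS (fun _ => cF); rewrite /= enum_ordSl.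
Qed.

Lemma computable_const n c : computable n (fun=> c).
Proof. by elim: c => [|c /computable_succ]; first by exists (RZero n). Qed.

Lemma computable_subst n (F : seq nat -> nat) G : computable n.+1 F -> computable n G ->
  computable n (fun e => F (G e :: e)).
Proof.
move=> cF cG.
pose gs (i : 'I_n.+1) := if unlift ord0 i is Some j then nth 0 ^~ (val j) else G.
have cgs i : computable n (gs i).
  by rewrite /gs; case: unliftP => //= j _; apply: computable_nth.
apply: computable_ext (computable_comp cF cgs) => v; congr F.
rewrite enum_ordSl /= /gs unlift_none; congr cons.
rewrite -map_comp; apply: (@eq_from_nth _ 0) => [|i].
  by rewrite size_map size_enum_ord size_tuple.
rewrite size_map size_enum_ord => lt_in.
by rewrite (nth_map (Ordinal lt_in)) ?size_enum_ord //= liftK /= nth_enum_ord.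
Qed.

Lemma computable_rec n F (G : seq nat -> nat -> nat -> nat) b :
    computable n F ->
    computable n.+2 (fun e => G (behead (behead e)) (head 0 e) (head 0 (behead e))) ->
    computable n b ->
  computable n (fun e => nat_rect (fun=> nat) (F e) (G e) (b e)).
Proof.
move=> [f fP] [g gP] cb.
suff cR : computable n.+1 (fun e =>
    nat_rect (fun=> nat) (F (behead e)) (G (behead e)) (head 0 e)).
  exact: (computable_subst cR cb).
exists (RPrec f g) => v.
exists (nat_rect (fun=> nat) (F (behead v)) (G (behead v))); split=> [|i _|].
- exact: (fP [tuple of behead v]).
- exact: (gP [tuple of i :: nat_rect _ _ _ i :: [tuple of behead v]]).
by rewrite /thead (tnth_nth 0) nth0.
Qed.

Ltac computable_var := match goal with
  | H : computable _ _ |- _ => first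
    [ exact H | exact (computable_behead H)
    | exact (computable_behead (computable_behead H))
    | exact (computable_behead (computable_behead (computable_behead H)))
    | exact (computable_behead (computable_behead (computable_behead
      (computable_behead H)))) ]
  | |- _ => first
    [ exact (computable_head _)
    | exact (computable_behead (computable_head _))
    | exact (computable_behead (computable_behead (computable_head _)))
    | exact (computable_behead (computable_behead (computable_behead
      (computable_head _)))) ]
  end.

Create HintDb computable.
#[global] Hint Extern 0 (computable _ _) => computable_var : computable.
#[global] Hint Resolve computable_const computable_succ : computable.

Ltac computability := auto 100 with computable nocore.

Lemma computable_add n F G : computable n F -> computable n G ->
  computable n (fun e => F e + G e).
Proof.
move=> cF cG.
have: computable n (fun e => nat_rect (fun=> nat) (F e) (fun i a => a.+1) (G e)).
  by apply: computable_rec; computability.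
apply: computable_ext => v; elim: (G v) => [|i /= ->]; first by rewrite addn0.
by rewrite addnS.
Qed.

Lemma computable_pred n F : computable n F ->
  computable n (fun e => (F e).-1).
Proof.
move=> cF.
have: computable n (fun e => nat_rect (fun=> nat) (0) (fun i a => i) (F e)).
  by apply: computable_rec; computability.
by apply: computable_ext => v; case: (F v).
Qed.

#[global] Hint Resolve computable_add computable_pred : computable.

Lemma computable_sub n F G : computable n F -> computable n G ->
  computable n (fun e => F e - G e).
Proof.
move=> cF cG.
have: computable n (fun e => nat_rect (fun=> nat) (F e) (fun i a => a.-1) (G e)).
  by apply: computable_rec; computability.
apply: computable_ext => v; elim: (G v) => [|i /= ->]; first by rewrite subn0.
by rewrite subnS.
Qed.

Lemma computable_mul n F G : computable n F -> computable n G ->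
  computable n (fun e => F e * G e).
Proof.
move=> cF cG.
have: computable n (fun e => nat_rect (fun=> nat) (0) (fun i a => F e + a) (G e)).
  by apply: computable_rec; computability.
apply: computable_ext => v; elim: (G v) => [|i /= ->]; first by rewrite muln0.
by rewrite mulnS.
Qed.
#[global] Hint Resolve computable_sub computable_mul : computable.

Lemma computable_exp n F G : computable n F -> computable n G ->
  computable n (fun e => F e ^ G e).
Proof.
move=> cF cG.
have: computable n (fun e => nat_rect (fun=> nat) (1) (fun i a => F e * a) (G e)).
  by apply: computable_rec; computability.
apply: computable_ext => v; elim: (G v) => [|i /= ->]; first by rewrite expn0.
by rewrite expnS.
Qed.
#[global] Hint Resolve computable_exp : computable.

Lemma computable_leq n F G : computable n F -> computable n G ->
  computable n (fun e => F e <= G e).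
Proof.
move=> cF cG; have: computable n (fun e => 1 - (F e - G e)) by computability.
by apply: computable_ext => v; rewrite -subn_eq0; case: (F v - G v).
Qed.

Lemma computable_and n (P Q : seq nat -> bool) : computable n (fun e => P e) ->
  computable n (fun e => Q e) -> computable n (fun e => P e && Q e).
Proof.
move=> cP cQ; have: computable n (fun e => P e * Q e) by computability.
by apply: computable_ext => v; case: (P v); case: (Q v).
Qed.

Lemma computable_not n (P : seq nat -> bool) : computable n (fun e => P e) ->
  computable n (fun e => ~~ P e).
Proof.
move=> cP; have: computable n (fun e => 1 - P e) by computability.
by apply: computable_ext => v; case: (P v).
Qed.
#[global] Hint Resolve computable_leq computable_and computable_not : computable.

Lemma computable_or n (P Q : seq nat -> bool) : computable n (fun e => P e) ->
  computable n (fun e => Q e) -> computable n (fun e => P e || Q e).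
Proof.
move=> cP cQ; have: computable n (fun e => ~~ (~~ P e && ~~ Q e)) by computability.
by apply: computable_ext => v; case: (P v); case: (Q v).
Qed.

Lemma computable_eq n (F G : seq nat -> nat) : computable n F -> computable n G ->
  computable n (fun e => F e == G e).
Proof.
move=> cF cG; have: computable n (fun e => (F e <= G e) && (G e <= F e)) by
  computability.
by apply: computable_ext => v; rewrite -eqn_leq.
Qed.

Lemma computable_if n (P : seq nat -> bool) F G : computable n (fun e => P e) ->
  computable n F -> computable n G -> computable n (fun e => if P e then F e else G e).
Proof.
move=> cP cF cG; have: computable n (fun e => P e * F e + ~~ P e * G e) by
  computability.
by apply: computable_ext => v; case: (P v); rewrite ?mul1n ?mul0n ?addn0.
Qed.
#[global] Hint Resolve computable_or computable_eq computable_if : computable.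

Lemma computable_iter n (f : seq nat -> nat -> nat) F G : computable n F ->
    computable n.+2 (fun e => f (behead (behead e)) (head 0 (behead e))) ->
    computable n G -> computable n (fun e => iter (G e) (f e) (F e)).
Proof.
move=> cF cf cG; have := computable_rec (G := fun e _ a => f e a) cF cf cG.
by apply: computable_ext => v; elim: (G v) => //= i ->.
Qed.

Definition bex b (P : pred nat) := has P (iota 0 b).
Definition ball b (P : pred nat) := all P (iota 0 b).
(** The value is [b] when the search fails. *)
Definition bmin b (P : pred nat) := find P (iota 0 b).

Lemma bexP b (P : pred nat) : reflect (exists2 i, i < b & P i) (bex b P).
Proof.
apply: (iffP hasP) => -[i]; first by rewrite mem_iota => lti Pi; exists i.
by exists i; rewrite // mem_iota.
Qed.

Lemma ballP b (P : pred nat) : reflect (forall i, i < b -> P i) (ball b P).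
Proof.
apply: (iffP allP) => H i; first by move=> lti; apply: H; rewrite mem_iota.
by rewrite mem_iota => /H.
Qed.

Lemma bminE b (P : pred nat) i : i <= b -> P i ->
  (forall j, j < i -> ~~ P j) -> bmin b P = i.
Proof.
move=> le_i Pi Pmin; rewrite /bmin -(subnKC le_i) iotaD find_cat size_iota.
have /negPf-> : ~~ has P (iota 0 i).
  by apply/hasPn => j; rewrite mem_iota => /Pmin.
by case: (b - i) => [|d] /=; rewrite ?Pi addn0.
Qed.

(** Weakening below the first variable: in a recursion the accumulator stands between the index and
    the environment. *)
Lemma computable_skip n (F : seq nat -> nat -> nat) :
    computable n.+1 (fun e => F (behead e) (head 0 e)) ->
  computable n.+2 (fun e => F (behead (behead e)) (head 0 e)).
Proof.
move=> cF.
pose gs (i : 'I_n.+1) := if unlift ord0 i is Some j then nth 0 ^~ (val j).+2 else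
  head 0.
have cgs i : computable n.+2 (gs i).
  rewrite /gs; case: unliftP => [j _|_]; last exact: computable_head.
  exact: (computable_nth (ltn_ord j : (val j).+2 < n.+2)).
apply: computable_ext (computable_comp cF cgs) => v.
rewrite enum_ordSl /= /gs unlift_none; congr (F _ _).
rewrite -map_comp; apply: (@eq_from_nth _ 0) => [|i].
  by rewrite size_map size_enum_ord !size_behead size_tuple.
rewrite size_map size_enum_ord => lt_in.
by rewrite (nth_map (Ordinal lt_in)) ?size_enum_ord //= liftK /= nth_enum_ord //
  !nth_behead.
Qed.

Lemma computable_ball n (P : seq nat -> nat -> bool) b : computable n b ->
    computable n.+1 (fun e => P (behead e) (head 0 e)) ->
  computable n (fun e => ball (b e) (P e)).
Proof.
move=> cb /(computable_skip (F := fun e i => P e i)) cP.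
have: computable n (fun e => nat_rect (fun=> nat) 1 (fun i a => P e i && (a != 0))
  (b e)).
  by apply: computable_rec; computability.
apply: computable_ext => v; rewrite /ball.
elim: (b v) => // i IH; rewrite -[in RHS]addn1 iotaD all_cat /= IH andbT andbC.
by case: all; case: (P v).
Qed.
#[global] Hint Resolve computable_ball computable_iter : computable.

Lemma computable_bex n (P : seq nat -> nat -> bool) b : computable n b ->
    computable n.+1 (fun e => P (behead e) (head 0 e)) ->
  computable n (fun e => bex (b e) (P e)).
Proof.
move=> cb cP; have: computable n (fun e => ~~ ball (b e) (fun i => ~~ P e i)).
  by computability.
by apply: computable_ext => v; rewrite /ball all_predC negbK.
Qed.
#[global] Hint Resolve computable_bex : computable.

Lemma computable_bmin n (P : seq nat -> nat -> bool) b : computable n b ->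
    computable n.+1 (fun e => P (behead e) (head 0 e)) ->
  computable n (fun e => bmin (b e) (P e)).
Proof.
move=> cb /(computable_skip (F := fun e i => P e i)) cP.
have: computable n (fun e => nat_rect (fun=> nat) 0
    (fun i a => if i <= a then if P e i then i else i.+1 else a) (b e)).
  by apply: computable_rec; computability.
apply: computable_ext => v; rewrite /bmin.
elim: (b v) => // i IH; rewrite -[in RHS]addn1 iotaD find_cat /= {}IH size_iota
  has_find.
rewrite size_iota ltnNge; case: leqP => //= le_i.
by rewrite add0n; case: (P v); rewrite ?addn0 ?addn1.
Qed.
#[global] Hint Resolve computable_bmin : computable.

(** * Lists coded as numbers *)

Definition code_cons x c := 2 ^ x * c.*2.+1.
(** The search may stop at [c], as both components of a pair are smaller than its code. On [0], the
    code of the empty list, it yields [0], which agrees with [head 0]. *)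
Definition nhd c := bmin c (fun x => bex c (fun d => c == code_cons x d)).
Definition ntl c := bmin c (fun d => bex c (fun x => c == code_cons x d)).
Definition ndrop c i := iter i ntl c.
Definition nnth c i := nhd (ndrop c i).
Definition nsize c := bmin c (fun i => ndrop c i == 0).

Lemma code_cons_inj x c y d : code_cons x c = code_cons y d -> x = y /\ c = d.
Proof.
move=> e; have: CodeSeq.code (x :: CodeSeq.decode c) = CodeSeq.code (y ::
  CodeSeq.decode d).
  by rewrite /= !CodeSeq.decodeK.
by move/(can_inj CodeSeq.codeK) => [-> /(can_inj CodeSeq.decodeK)].
Qed.

Lemma ltn_code_cons x c : x < code_cons x c /\ c < code_cons x c.
Proof.
split; first by apply: (@leq_trans (2 ^ x)); [exact: ltn_expl | exact: leq_pmulr].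
apply: (@leq_trans c.*2.+1); first by rewrite ltnS -addnn leq_addr.
by rewrite leq_pmull // expn_gt0.
Qed.

Lemma nhd_cons x c : nhd (code_cons x c) = x.
Proof.
have [ltx ltc] := ltn_code_cons x c; apply: bminE (ltnW ltx) _ _.
  by apply/bexP; exists c.
by move=> j lt_j; apply/bexP => -[d _ /eqP /code_cons_inj[e]]; rewrite e ltnn in lt_j.
Qed.

Lemma ntl_cons x c : ntl (code_cons x c) = c.
Proof.
have [ltx ltc] := ltn_code_cons x c; apply: bminE (ltnW ltc) _ _.
  by apply/bexP; exists x.
by move=> j lt_j; apply/bexP => -[d _ /eqP /code_cons_inj[_ e]]; rewrite e ltnn in lt_j.
Qed.

Lemma nhd_code s : nhd (CodeSeq.code s) = head 0 s.
Proof. by case: s => //= x s; apply: nhd_cons. Qed.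

Lemma ntl_code s : ntl (CodeSeq.code s) = CodeSeq.code (behead s).
Proof. by case: s => //= x s; apply: ntl_cons. Qed.

Lemma ndrop_code s i : ndrop (CodeSeq.code s) i = CodeSeq.code (drop i s).
Proof.
elim: i => [|i IHi]; first by rewrite drop0.
by rewrite /ndrop iterS -/(ndrop _ _) IHi ntl_code -drop1 drop_drop add1n.
Qed.

Lemma nnth_code s i : nnth (CodeSeq.code s) i = nth 0 s i.
Proof. by rewrite /nnth ndrop_code nhd_code -nth0 nth_drop addn0. Qed.

Lemma leq_size_code s : size s <= CodeSeq.code s.
Proof.
elim: s => //= x s; have [_] := ltn_code_cons x (CodeSeq.code s).
by rewrite /code_cons => *; lia.
Qed.

Lemma code_eq0 s : (CodeSeq.code s == 0) = (s == [::]).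
Proof. by case: s => // x s; rewrite muln_eq0 expn_eq0. Qed.

Lemma nsize_code s : nsize (CodeSeq.code s) = size s.
Proof.
apply: bminE (leq_size_code s) _ _; first by rewrite ndrop_code drop_size.
by move=> j; rewrite ndrop_code code_eq0 -size_eq0 size_drop subn_eq0 -ltnNge.
Qed.

Lemma computable_code_cons n F G : computable n F -> computable n G ->
  computable n (fun e => code_cons (F e) (G e)).
Proof.
move=> cF cG; have: computable n (fun e => 2 ^ F e * (G e + G e).+1) by computability.
by apply: computable_ext => v; rewrite addnn.
Qed.
#[global] Hint Resolve computable_code_cons : computable.

Lemma computable_nhd n F : computable n F -> computable n (fun e => nhd (F e)).
Proof. by move=> cF; rewrite /nhd; computability. Qed.

Lemma computable_ntl n F : computable n F -> computable n (fun e => ntl (F e)).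
Proof. by move=> cF; rewrite /ntl; computability. Qed.
#[global] Hint Resolve computable_nhd computable_ntl : computable.

Lemma computable_ndrop n F G : computable n F -> computable n G ->
  computable n (fun e => ndrop (F e) (G e)).
Proof. by move=> cF cG; apply: (computable_iter (f := fun=> ntl)); computability. Qed.
#[global] Hint Resolve computable_ndrop : computable.

Lemma computable_nnth n F G : computable n F -> computable n G ->
  computable n (fun e => nnth (F e) (G e)).
Proof. by move=> cF cG; rewrite /nnth; computability. Qed.

Lemma computable_nsize n F : computable n F -> computable n (fun e => nsize (F e)).
Proof. by move=> cF; rewrite /nsize; computability. Qed.
#[global] Hint Resolve computable_nnth computable_nsize : computable.

(** * The decision procedure *)

Definition nhas c (P : pred nat) := bex (nsize c) (fun i => P (nnth c i)).

Lemma nhas_code s (P : pred nat) : nhas (CodeSeq.code s) P = has P s.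
Proof.
apply/bexP/hasP => [[i]|[x /(nthP 0)[i lti <-] Px]].
  by rewrite nsize_code nnth_code => lti Pi; exists (nth 0 s i); rewrite ?mem_nth.
by exists i; rewrite ?nsize_code ?nnth_code.
Qed.

Lemma computable_nhas n (P : seq nat -> nat -> bool) F : computable n F ->
    computable n.+1 (fun e => P (behead e) (head 0 e)) ->
  computable n (fun e => nhas (F e) (P e)).
Proof.
move=> cF /(computable_skip (F := fun e i => P e i)) cP; rewrite /nhas.
have /(computable_subst cP) cP' : computable n.+1 (fun e => nnth (F (behead e))
  (head 0 e)).
  by computability.
by apply: (computable_bex (P := fun e i => P e (nnth (F e) i))); computability.
Qed.
#[global] Hint Resolve computable_nhas : computable.

Definition napp u s :=
  nat_rect (fun=> nat) s (fun i a => code_cons (nnth u (nsize u - i.+1)) a) (nsize u).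

Definition nrev s := nat_rect (fun=> nat) 0 (fun i a => code_cons (nnth s i) a)
  (nsize s).

Lemma napp_code u s :
  napp (CodeSeq.code u) (CodeSeq.code s) = CodeSeq.code (u ++ s).
Proof.
rewrite /napp nsize_code.
suff rec i : i <= size u -> nat_rect (fun=> nat) (CodeSeq.code s)
    (fun i a => code_cons (nnth (CodeSeq.code u) (size u - i.+1)) a) i =
    CodeSeq.code (drop (size u - i) u ++ s).
  by rewrite rec // subnn drop0.
elim: i => [|i IHi] lti /=; first by rewrite subn0 drop_size.
rewrite IHi 1?ltnW // nnth_code (drop_nth 0 (n := size u - i.+1)); last by lia.
by rewrite subnSK.
Qed.

Lemma nrev_code s : nrev (CodeSeq.code s) = CodeSeq.code (rev s).
Proof.
rewrite /nrev nsize_code.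
suff rec i : i <= size s -> nat_rect (fun=> nat) 0
    (fun i a => code_cons (nnth (CodeSeq.code s) i) a) i = CodeSeq.code (rev (take
      i s)).
  by rewrite rec // take_size.
elim: i => [|i IHi] lti /=; first by rewrite take0.
by rewrite IHi 1?ltnW // nnth_code (take_nth 0) // rev_rcons.
Qed.

Lemma computable_napp n F G : computable n F -> computable n G ->
  computable n (fun e => napp (F e) (G e)).
Proof. by move=> cF cG; rewrite /napp; apply: computable_rec; computability. Qed.

Lemma computable_nrev n F : computable n F -> computable n (fun e => nrev (F e)).
Proof. by move=> cF; rewrite /nrev; apply: computable_rec; computability. Qed.
#[global] Hint Resolve computable_napp computable_nrev : computable.

Definition nconf p i j s := code_cons p (code_cons i (code_cons j (code_cons s 0))).

Definition ntop s := if s == 0 then 0 else (nhd s).+1.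

Definition nreads y a i i' :=
  (i' == i) && [|| a == 0, i == 0 | i == nsize y]
  || [&& i' == i.+1, i < nsize y & a == (nnth y i).+1].

(** The indices follow [code_pda] ([4] final states, [5] transitions, [6] flips), [code_transition]
    (state, letter, top, target, string) and [nconf] (state, position, flips left, pushdown). On an
    empty pushdown [ntl] gives [0], so the string is written above the marker. *)
Definition nstep m y c d :=
  nhas (nnth m 5) (fun t =>
    [&& nnth t 0 == nnth c 0, nnth t 2 == ntop (nnth c 3)
      & bex (nsize y).+1 (fun i => nreads y (nnth t 1) (nnth c 1) i
          && (d == nconf (nnth t 3) i (nnth c 2) (napp (nnth t 4) (ntl (nnth c 3)))))])
  || (0 < nnth c 2) && nhas (nnth m 6) (fun t => (nnth t 0 == nnth c 0)
       && (d == nconf (nnth t 1) (nnth c 1) (nnth c 2).-1 (nrev (nnth c 3)))).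

Definition nfinal m y c :=
  nhas (nnth m 4) (fun p => p == nnth c 0) && (nnth c 1 == nsize y).

Definition ntrace m y k t :=
  [&& nnth t 0 == nconf (nnth m 3) 0 k 0,
      ball (nsize t).-1 (fun i => nstep m y (nnth t i) (nnth t i.+1))
    & nfinal m y (nnth t (nsize t).-1)].

Lemma computable_nstep n F G H K : computable n F -> computable n G ->
    computable n H -> computable n K ->
  computable n (fun e => nstep (F e) (G e) (H e) (K e)).
Proof.
by move=> cF cG cH cK; rewrite /nstep /nreads /ntop /nconf; computability.
Qed.
#[global] Hint Resolve computable_nstep : computable.

Lemma computable_ntrace n F G H K : computable n F -> computable n G ->
    computable n H -> computable n K ->
  computable n (fun e => ntrace (F e) (G e) (H e) (K e)).
Proof.
by move=> cF cG cH cK; rewrite /ntrace /nfinal /nconf; computability.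
Qed.
#[global] Hint Resolve computable_ntrace : computable.

(** * Correctness of the check of coded runs *)

Section Checker.

Variables (s g q : nat) (M : flip_pda 'I_s 'I_g 'I_q) (y : seq 'I_s).

Local Notation m := (code_pda M).
Local Notation yc := (CodeSeq.code (map val y)).
Local Notation state := ('I_q * 'I_(size y).+1)%type.
Local Notation step_tracked := (step (tracked M (y := y))).
Local Notation accept_tracked :=
  (accept_in (tracked M (y := y)) (tracked_flip M (y := y)) (tracked_final M (y := y))).

(* [j] is the number of flips still allowed. *)
Definition enc j (c : state * seq 'I_g) :=
  CodeSeq.code [:: val c.1.1; val c.1.2; j; CodeSeq.code (map val c.2)].

Local Arguments CodeSeq.code : simpl never.

Lemma nnth_enc j c i :
  nnth (enc j c) i = nth 0 [:: val c.1.1; val c.1.2; j; CodeSeq.code (map val c.2)] i.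
Proof. exact: nnth_code. Qed.

Lemma ntop_code (w : seq 'I_g) : ntop (CodeSeq.code (map val w)) = code_option
  (ohead w).
Proof. by case: w => // x w; rewrite /ntop code_eq0 nhd_code. Qed.

Lemma code_option_inj n : injective (@code_option n).
Proof. by move=> [i|] [j|] //= [/val_inj->]. Qed.

Lemma nreads_code (a : option 'I_s) i i' :
  nreads yc (code_option a) i i' = reads y a i i'.
Proof.
rewrite /nreads /reads nsize_code size_map nnth_code; congr (_ && _ || _).
  by case: a.
case: eqP => //= _; case: (ltnP i (size y)) => //= lti.
case: a => [a|] /=; last by case E: (onth y i) (onthTE y i) => //; rewrite lti.
by rewrite eqSS (nth_map a) // -(odflt_onth a); case E: (onth y i) (onthTE y i);
  rewrite lti.
Qed.

Lemma nstep_spec j c d : reflect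
  ((exists2 c', step_tracked c c' & d = enc j c') \/
   exists i p, [/\ j = i.+1, tracked_flip M c.1 p & d = enc i (p, rev c.2)])
  (nstep m yc (enc j c) d).
Proof.
case: c => [[p i] w]; rewrite /nstep /code_pda !nnth_enc !nnth_code /= !nhas_code
  !has_map.
rewrite !nsize_code size_map ntl_code behead_map ntop_code.
apply: (iffP orP) => -[H|H]; [left | right | left | right]; move: H.
- case/hasP => -[[[[p0 a] x] r] u] tr /=; rewrite !nnth_code /= => /and3P[/eqP ep /eqP].
  move/code_option_inj => ex /bexP[i' lti /andP[]].
  rewrite nreads_code napp_code -map_cat => rd /eqP ->.
  have ep' : p0 = p by apply: val_inj.
  rewrite ep' in tr; exists ((r, Ordinal lti), u ++ behead w) => //.
  case: w ex => [|z w] ex; rewrite ex in tr.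
    rewrite cats0; apply: (@StepBottom _ _ (tracked M (y := y)) (p, i) (r, Ordinal
      lti)).
    by exists a.
  apply: (@StepTop _ _ (tracked M (y := y)) (p, i) z (r, Ordinal lti)).
  by exists a.
- case/andP; case: j => // j _ /hasP[[p0 r]]; rewrite mem_enum => tr /=.
  rewrite !nnth_code /= nrev_code -map_rev => /andP[/eqP ep /eqP ->].
  exists j, (r, i); split=> //; split=> //.
  by have <- : p0 = p by apply: val_inj.
- case=> c' st ->; move E: (p, i, w) st => c st.
  case: st E => [[p0 i0] x [r i'] u t|[p0 i0] [r i'] u] [a /= tr rd] [-> -> ->].
    apply/hasP; exists (p0, a, Some x, r, u) => //=.
    rewrite !nnth_code /= !eqxx /=; apply/bexP; exists i' => //.
    by rewrite nreads_code napp_code -map_cat rd eqxx.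
  apply/hasP; exists (p0, a, None, r, u) => //=.
  rewrite !nnth_code /= !eqxx /=; apply/bexP; exists i' => //.
  by rewrite nreads_code (napp_code _ [::]) cats0 rd eqxx.
case=> j' [[r i'] [-> [/= tr <-] ->]] /=; apply/hasP; exists (p, r).
  by rewrite mem_enum.
by rewrite /= !nnth_code /= nrev_code -map_rev !eqxx.
Qed.

Lemma nfinal_spec j c : reflect (tracked_final M c.1) (nfinal m yc (enc j c)).
Proof.
case: c => [[p i] w]; rewrite /nfinal /code_pda !nnth_enc !nnth_code /= nhas_code
  has_map nsize_code size_map.
apply: (iffP andP) => -[].
  move=> /hasP[p0]; rewrite mem_enum /= => Fp /eqP/val_inj <- /eqP ei; split=> //.
  exact: val_inj.
move=> /= Fp ->; split=> //; apply/hasP; exists p; rewrite ?mem_enum //=.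
Qed.

Lemma ntrace_path k d ts : ntrace m yc k (CodeSeq.code (d :: ts)) =
  [&& d == CodeSeq.code [:: val (init M); 0; k; 0], path (nstep m yc) d ts
    & nfinal m yc (last d ts)].
Proof.
have init_m : nnth m 3 = val (init M) by apply: nnth_code.
rewrite /ntrace init_m nsize_code !nnth_code /=; congr [&& _, _ & _].
  by apply/ballP/(pathP 0) => H i /H; rewrite !nnth_code.
by rewrite (last_nth 0).
Qed.

Lemma path_accept j c ts : path (nstep m yc) (enc j c) ts ->
  nfinal m yc (last (enc j c) ts) -> exists n, accept_tracked n j c.
Proof.
elim: ts j c => [|d ts IH] j c /=.
  by move=> _ /nfinal_spec Fc; exists 0; apply: AcceptFinal.
case/andP => /nstep_spec[[c' st ->]|[i [p [-> fl ->]]]] /IH/[apply]-[n H].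
  by exists n.+1; apply: AcceptStep H.
by exists n.+1; case: c fl H => p0 w fl H; apply: AcceptFlip H.
Qed.

(** Length, remaining flips and heights are bounded along with the trace, since they bound its
    code. *)
Lemma accept_path N n j c h :
    (forall p x r u, tracked M (y := y) p x r u -> size u <= N) ->
    accept_tracked n j c -> size c.2 + N * n <= h ->
  exists ts, [/\ size ts <= n, path (nstep m yc) (enc j c) ts,
    nfinal m yc (last (enc j c) ts) &
    forall d, d \in enc j c :: ts ->
      exists i c', [/\ d = enc i c', i <= j & size c'.2 <= h]].
Proof.
move=> trN; elim=> {n j c} [n j c Fc|n j c c' st _ IH|n j p r w pr _ IH] leh.
- exists [::]; split=> // [|d]; first exact/nfinal_spec.
  by rewrite inE => /eqP ->; exists j, c; split=> //; apply: leq_trans leh;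
    apply: leq_addr.
- have sz : size c'.2 + N * n <= h.
    by have := step_size trN st; move: leh; rewrite mulnS; lia.
  have [ts [lets pts fts bts]] := IH sz.
  exists (enc j c' :: ts); split=> //=; first by rewrite pts andbT;
    apply/nstep_spec; left; exists c'.
  move=> d; rewrite inE => /orP[/eqP ->|/bts//].
  by exists j, c; split=> //; apply: leq_trans leh; apply: leq_addr.
have sz : size (rev w) + N * n <= h by move: leh; rewrite size_rev mulnS /=; lia.
have [ts [lets pts fts bts]] := IH sz.
exists (enc j (r, rev w) :: ts); split=> //=.
  by rewrite pts andbT; apply/nstep_spec; right; exists j, r.
move=> d; rewrite inE => /orP[/eqP ->|/bts[i [c' [-> le1 le2]]]].
  by exists j.+1, (p, w); split=> //; apply: leq_trans leh; apply: leq_addr.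
by exists i, c'; split=> //; apply: leqW.
Qed.

End Checker.

(** * Size bounds and the algorithm *)

Definition code_bound l e := 2 ^ (e.+2 * l).

(** If the tail has code [c < B], adding an entry [x <= e] gives
    [2 ^ x * (2 * c + 1) < 2 ^ x * 4 * B], at most [2 ^ e.+2 * B]. *)
Lemma ltn_code_bound e l xs : size xs <= l -> all (fun x => x <= e) xs ->
  CodeSeq.code xs < code_bound l e.
Proof.
elim: xs l => [|x xs IH] l; first by rewrite expn_gt0.
case: l => // l /= /IH{}IH /andP[le_x /IH]; rewrite /code_bound (mulnS e.+2) expnD.
set B := 2 ^ (_ * l); set c := CodeSeq.code xs => lt_c.
apply: (@leq_trans (2 ^ x * (2 * B).+1)).
  by rewrite ltn_pmul2l ?expn_gt0 //; move: lt_c; rewrite -muln2; lia.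
have B0 : 0 < B by rewrite expn_gt0.
apply: (@leq_trans (2 ^ x * (4 * B))); first by rewrite leq_mul2l; apply/orP;
  right; lia.
by rewrite mulnA leq_mul2r -(expnD 2 x 2) leq_exp2l // addn2 !ltnS le_x orbT.
Qed.

Definition word_bound n k l := (k + l).+1 * (run_abs_card k n * run_abs_card k n).

(** Bounds the number of states of the product with the positions of a word of length at most
    [word_bound n k l]. *)
Definition system_bound n k l := n * (word_bound n k l).+1.

Definition time_bound n k l := iter k.+1 (grow (system_bound n k l) k) 0.

Definition conf_bound n k l :=
  code_bound 4 (n + word_bound n k l + k
    + code_bound (system_bound n k l * time_bound n k l) n).

Definition trace_bound n k l := code_bound (time_bound n k l).+1 (conf_bound n k l).

(** All numbers below the bound are tried as words; those with a letter outside the alphabet or of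
    excessive length pass trivially. *)
Definition decide_with n k l m :=
  ball (code_bound (word_bound n k l) n) (fun y =>
    [|| nhas y (fun x => nnth m 0 <= x), word_bound n k l < nsize y
      | bex (trace_bound n k l) (fun t => ntrace m y k t)]).

(** The code of the instance itself serves as the bound for [s], [g], [q] and the strings written,
    because entries and lengths of a list never exceed its code. *)
Definition decide n := decide_with n (nnth n 0) (nnth n 1) (nnth n 2).

Section Correctness.

Variables (s g q k l : nat) (M : flip_pda 'I_s 'I_g 'I_q) (n : nat).
Hypotheses (le_s : s <= n) (le_g : g <= n) (le_q : q <= n).
Hypothesis delta_size : forall t, t \in delta M -> size t.2 <= n.

Local Notation m := (code_pda M).
Let W := word_bound n k l.
Let N := system_bound n k l.

Lemma ntrace_infixes (y : seq 'I_s) : size y <= W ->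
  bex (trace_bound n k l) (fun t => ntrace m (CodeSeq.code (map val y)) k t) <->
  infixes (language M k) y.
Proof.
move=> ley; rewrite infixes_tracked; split.
  case/bexP => t _; rewrite -(CodeSeq.decodeK t); case: CodeSeq.decode => [|d ts].
    (* The empty trace is rejected: its missing first configuration is read as [0], which is not the
       code of a nonempty list. *)
    by rewrite /ntrace nnth_code /nconf -[code_cons _ _]/(CodeSeq.code [:: _; _; _;
      _]) eq_sym code_eq0.
  rewrite ntrace_path => /and3P[/eqP -> pts fts].
  have := @path_accept _ _ _ M y k ((init M, ord0), [::]) ts pts fts.
  by case=> n0 /accept_in_acc.
have leN : n <= N by rewrite /N leq_pmulr.
have trN p x r u : tracked M (y := y) p x r u -> size u <= N.
  by case=> a /delta_size le_u _; apply: leq_trans le_u leN.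
have cardS : #|{: 'I_q * 'I_(size y).+1}| <= N.
  by rewrite card_prod !card_ord leq_mul.
have cardG : #|'I_g| <= N by rewrite card_ord (leq_trans le_g).
move/(acc_time cardS cardG trN (leqnn k))/(_ (leqnn 0)) => acc_c.
(* The run starts at height [0], and each of its moves adds at most [N]. *)
have [|ts [lets pts fts bts]] := accept_path (h := N * time_bound n k l) trN acc_c.
  by [].
apply/bexP; exists (CodeSeq.code (enc (g := g) (y := y) k ((init M, ord0), [::]) ::
  ts)); last first.
  by rewrite ntrace_path pts fts eqxx.
apply: ltn_code_bound => //; apply/allP => d /bts[j [[[p i] w] [-> /= lej lew]]].
apply/ltnW/ltn_code_bound => //=.
have ltw : CodeSeq.code (map val w) < code_bound (N * time_bound n k l) n.
  apply: ltn_code_bound; first by rewrite size_map.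
  by apply/allP => _ /mapP[x _ ->]; apply: ltnW (leq_trans (ltn_ord x) le_g).
have := ltn_ord p; have := ltn_ord i; rewrite -/N -/W in ltw *.
move=> lti ltp; rewrite andbT; apply/and4P; split; try lia.
exact: leq_trans (ltnW ltw) (leq_addl _ _).
Qed.

Lemma decide_with_dense : reversal_bound M k l ->
  (decide_with n k l m <-> dense (language M k)).
Proof.
move=> rev_l; split=> [/ballP dec|dn]; last first.
  apply/ballP => c _; rewrite -(CodeSeq.decodeK c); set ys := CodeSeq.decode c.
  rewrite nhas_code nsize_code /= nnth_code /=; apply/or3P.
  have [?|lt_ys] := boolP (has _ ys); first by constructor 1.
  have [lt_W|le_W] := ltnP (word_bound n k l) (size ys); first by constructor 2.
  constructor 3; have [y Ey] : exists y : seq 'I_s, ys = map val y.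
    exists (pmap insub ys); elim: ys lt_ys {le_W} => //= x ys IH.
    by rewrite negb_or -ltnNge => /andP[ltx /IH {1}->]; rewrite insubT.
  rewrite Ey; apply/ntrace_infixes; last exact: dn.
  by move: le_W; rewrite Ey size_map.
apply: (dense_short (N := n)) rev_l _; rewrite ?card_ord // => y ley.
apply/ntrace_infixes => //.
have /dec/or3P[||//] : CodeSeq.code (map val y) < code_bound (word_bound n k l) n.
- apply: ltn_code_bound; first by rewrite size_map.
  by apply/allP => _ /mapP[x _ ->]; apply: ltnW (leq_trans (ltn_ord x) le_s).
- rewrite nhas_code /= nnth_code /= => /hasP[_ /mapP[x _ ->]].
  by rewrite leqNgt ltn_ord.
by rewrite nsize_code size_map ltnNge ley.
Qed.

End Correctness.

Lemma ltn_code_mem x xs : x \in xs -> x < CodeSeq.code xs.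
Proof. by move/(allP (CodeSeq.ltn_code xs)). Qed.

Lemma decide_dense (s g q k l : nat) (M : flip_pda 'I_s 'I_g 'I_q) :
  reversal_bound M k l -> (decide (code_instance k l M) <-> dense (language M k)).
Proof.
set n := code_instance k l M => rev_l.
have lt_m : code_pda M < n by apply: ltn_code_mem; rewrite !inE eqxx !orbT.
have lt_n x : x \in [:: s; g; q] -> x <= n.
  move=> x_in; apply/ltnW/(ltn_trans _ lt_m)/ltn_code_mem.
  by move: x_in; rewrite !inE => /or3P[] ->; rewrite ?orbT.
rewrite /decide /n /code_instance !nnth_code /= -/n.
apply: decide_with_dense rev_l; try by apply: lt_n; rewrite !inE eqxx ?orbT.
move=> [[[[p a] x] r] u] t_in /=.
have lt1 : CodeSeq.code (map val u) < code_transition (p, a, x, r, u).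
  by apply: ltn_code_mem; rewrite !inE eqxx !orbT.
have lt2 := ltn_code_mem (map_f (@code_transition s g q) t_in).
have lt3 : CodeSeq.code [seq code_transition t | t <- delta M] < code_pda M.
  by apply: ltn_code_mem; rewrite !inE eqxx !orbT.
rewrite -(size_map val); apply: leq_trans (leq_size_code _) _.
exact: ltnW (ltn_trans lt1 (ltn_trans lt2 (ltn_trans lt3 lt_m))).
Qed.

(** * Computability of the bounds and of the decision *)

Lemma computable_tower n F G : computable n F -> computable n G ->
  computable n (fun e => tower (F e) (G e)).
Proof.
move=> cF cG; have: computable n (fun e => nat_rect (fun=> nat)
    (2 * 2 ^ (F e * (F e).+1 ^ F e))
    (fun _ a => 2 ^ ((F e).+1 * a) * 2 ^ (F e * (F e).+1 ^ F e)) (G e)).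
  by apply: computable_rec; computability.
by apply: computable_ext => v; elim: (G v) => //= i ->.
Qed.
#[global] Hint Resolve computable_tower : computable.

Lemma computable_run_abs_card n F G : computable n F -> computable n G ->
  computable n (fun e => run_abs_card (F e) (G e)).
Proof. by move=> cF cG; rewrite /run_abs_card /abs_card; computability. Qed.
#[global] Hint Resolve computable_run_abs_card : computable.

Lemma computable_pop_time n F G : computable n F -> computable n G ->
  computable n (fun e => pop_time (F e) (G e)).
Proof.
move=> cF cG; rewrite /pop_time.
by apply: (computable_iter (f := fun e m => ((F e).+1 * m).+1)); computability.
Qed.
#[global] Hint Resolve computable_pop_time : computable.

Lemma computable_word_bound n F G H : computable n F -> computable n G ->
  computable n H -> computable n (fun e => word_bound (F e) (G e) (H e)).
Proof. by move=> cF cG cH; rewrite /word_bound; computability. Qed.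
#[global] Hint Resolve computable_word_bound : computable.

Lemma computable_system_bound n F G H : computable n F -> computable n G ->
  computable n H -> computable n (fun e => system_bound (F e) (G e) (H e)).
Proof. by move=> cF cG cH; rewrite /system_bound; computability. Qed.
#[global] Hint Resolve computable_system_bound : computable.

Lemma computable_time_bound n F G H : computable n F -> computable n G ->
  computable n H -> computable n (fun e => time_bound (F e) (G e) (H e)).
Proof.
move=> cF cG cH; rewrite /time_bound.
apply: (computable_iter (f := fun e => grow (system_bound (F e) (G e) (H e)) (G e)));
  rewrite /grow /bottom_time; computability.
Qed.
#[global] Hint Resolve computable_time_bound : computable.

Lemma computable_code_bound n F G : computable n F -> computable n G ->
  computable n (fun e => code_bound (F e) (G e)).
Proof. by move=> cF cG; rewrite /code_bound; computability. Qed.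
#[global] Hint Resolve computable_code_bound : computable.

Lemma computable_trace_bound n F G H : computable n F -> computable n G ->
  computable n H -> computable n (fun e => trace_bound (F e) (G e) (H e)).
Proof. by move=> cF cG cH; rewrite /trace_bound /conf_bound; computability. Qed.
#[global] Hint Resolve computable_trace_bound : computable.

Lemma computable_decide : computable 1 (fun e => decide (head 0 e)).
Proof.
rewrite /decide /decide_with.
computability.
Qed.

Theorem corollary6 :
  exists f : recfun 1,
    forall (s g q k l : nat) (M : flip_pda 'I_s 'I_g 'I_q),
      reversal_bound M k l ->
      (dense (language M k) -> computes f [tuple code_instance k l M] 1) /\
      (~ dense (language M k) -> computes f [tuple code_instance k l M] 0).
Proof.
have [f fP] := computable_decide; exists f => s g q k l M /decide_dense decP.
have := fP [tuple code_instance k l M]; rewrite [head _ _]/=.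
by case: (decide _) decP => -[dec1 dec2] comp; split=> // dn;
  [case: dn; apply: dec1 | have := dec2 dn].
Qed.
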